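(* Let $G=\mathrm{PSL}(3,3)$ and let $x\in G$ be a non-identity element. Then $|x|\in\{2,3,4,6,8,13\}$. Every maximal subgroup of $G$ is isomorphic to one of $H=C_3^2\rtimes \mathrm{GL}(2,3)$ (of order $432$), $C_{13}\rtimes C_3$ (of order $39$), $S_4$, and $\mathrm{Sol}_G(x)$ is the union of the maximal subgroups of $G$ containing $x$. The numbers $(h,f,s)$ of maximal subgroups of $G$ containing $x$ that are isomorphic to $H$, $C_{13}\rtimes C_3$, $S_4$ respectively, and the values of $|\mathrm{Sol}_G(x)|$ and $|N_G(\langle x\rangle)|$, are as follows. (1) If $|x|=2$: $(10,0,18)$, $|\mathrm{Sol}_G(x)|=2832$, $|N_G(\langle x\rangle)|=48$. (2) If $|x|=3$, then $|N_G(\langle x\rangle)|\in\{18,108\}$. If $|N_G(\langle x\rangle)|=18$: $(2,6,3)$ and $|\mathrm{Sol}_G(x)|=1026$. If $|N_G(\langle x\rangle)|=108$: $(8,0,0)$ and $|\mathrm{Sol}_G(x)|=2376$. (3) If $|x|=4$: $(2,0,2)$, $|\mathrm{Sol}_G(x)|=848$, $|N_G(\langle x\rangle)|=16$. (4) If $|x|=6$: $(4,0,0)$, $|\mathrm{Sol}_G(x)|=1368$, $|N_G(\langle x\rangle)|=12$. (5) If $|x|=8$: $(2,0,0)$, $|\mathrm{Sol}_G(x)|=816$, $|N_G(\langle x\rangle)|=16$. (6) If $|x|=13$: $(0,1,0)$, $|\mathrm{Sol}_G(x)|=39$, $|N_G(\langle x\rangle)|=39$.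
   Context: For a finite group $G$ and $x\in G$, the solubilizer of $x$ is the set $\mathrm{Sol}_G(x)=\{y\in G\mid \langle x,y\rangle \text{ is soluble}\}$. $|x|$ is the order of $x$, $C_n$ is the cyclic group of order $n$, $S_4$ is the symmetric group of degree $4$, and $N_G(\langle x\rangle)$ is the normalizer in $G$ of the cyclic subgroup generated by $x$. $H=C_3^2\rtimes\mathrm{GL}(2,3)$ is the affine group $\mathrm{AGL}(2,3)$ (the two classes of such subgroups are the point and line stabilizers in the projective plane over the field with $3$ elements). *)

(* Defs.v *)
From HB Require Import structures.
From mathcomp Require Import all_boot all_order all_algebra all_fingroup.
From mathcomp Require Import all_solvable all_character.

Set Implicit Arguments.
Unset Strict Implicit.
Unset Printing Implicit Defensive.

Local Open Scope group_scope.

Definition SL_set (n : nat) (F : finFieldType) : {set {'GL_n[F]}} :=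
  [set u : {'GL_n[F]} | (\det (GLval u) == 1)%R].

Lemma SL_group_set (n : nat) (F : finFieldType) : group_set (SL_set n F).
Proof.
apply/group_setP; split=> [|u v]; rewrite !inE; first by rewrite GL_1E det1.
by move=> /eqP du /eqP dv; rewrite GL_MxE det_mulmx du dv GRing.mulr1.
Qed.

Definition SL (n : nat) (F : finFieldType) : {group {'GL_n[F]}} :=
  Group (SL_group_set n F).

Definition PSL (n : nat) (F : finFieldType) : {group coset_of 'Z(SL n F)} :=
  (SL n F / 'Z(SL n F))%G.

(* The semidirect product F^n ><| GL(n, F) for the natural right action on row
   vectors; as for {'GL_n[F]}, the dimension is n.-1.+1, i.e. n when n > 0.   *)
Definition AGL_type (n : nat) (F : finFieldType) : finGroupType :=
  sdprod_by ('MR (GLrepr F n.-1))%gact.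

Definition AGL (n : nat) (F : finFieldType) : {group AGL_type n F} :=
  [set: AGL_type n F]%G.

(* The nonabelian C_13 ><| C_3: a generator of C_3 acts on C_13 by b |-> b ^+ 3
   (an automorphism of order 3, as 3 ^ 3 = 1 %[mod 13]).                      *)
Definition C13_C3 : {group Extremal.gtype 13 3 3} :=
  [set: Extremal.gtype 13 3 3]%G.

Definition Sol (gT : finGroupType) (G : {set gT}) (x : gT) : {set gT} :=
  [set y in G | solvable <<[set x; y]>>].

Definition maximals_at (gT : finGroupType) (G : {set gT}) (x : gT) :
    {set {group gT}} :=
  [set M : {group gT} | maximal M G & x \in M].

Definition num_maximals_at (gT rT : finGroupType)
    (G : {set gT}) (x : gT) (K : {set rT}) : nat :=
  #|[set M in maximals_at G x | M \isog K]|.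

Definition hfs (gT : finGroupType) (G : {set gT}) (x : gT) : nat * nat * nat :=
  (num_maximals_at G x (AGL 2 'F_3),
   num_maximals_at G x C13_C3,
   num_maximals_at G x [set: 'S_4]).

(* Main.v *)
Require Import Defs.
From mathcomp Require Import all_boot all_order all_algebra all_fingroup.
From mathcomp Require Import all_solvable all_character.
From HB Require Import structures.

Set Implicit Arguments.
Unset Strict Implicit.
Unset Printing Implicit Defensive.

Local Open Scope group_scope.

Local Notation F3 := 'F_3.

(** PSL(3,3) is SL(3,3), because the only scalar of determinant 1 is the
    identity. The proof describes its proper subgroups by their action on the
    space of row vectors of length 3 over the field with three elements, and
    obtains all numbers by counting in the list of the 5616 matrices of
    determinant 1.

    Classes. For seven explicit elements r the normalizer of <r> is counted.
    The class of <r> contributes |G : N(<r>)| times phi(|r|) elements, and the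
    seven contributions add up to |G| - 1, so every nontrivial cyclic subgroup
    is conjugate to one of the seven ([cycle_conj_rep]). All quantities of the
    theorem depend on the class of <x> only.

    Maximal subgroups. Four subgroups are fixed ([std]): the stabilizers of a
    point and of a line of the projective plane, the normalizer of a Singer
    cycle of order 13, and the normalizer of the group of diagonal matrices,
    that is, the stabilizer of a frame. Every proper subgroup M lies in a
    conjugate of one of them ([proper_sub_std]). If the order of M has at most
    two prime divisors then M is soluble, by the theorem of Burnside, and has
    a normal elementary abelian subgroup Q. If Q is a 3-group, its fixed
    vectors form a proper M-invariant subspace. If Q is a 2-group, it can be
    diagonalized, and M normalizes the diagonal group or centralizes an
    involution, which has a one-dimensional eigenspace. If Q is a 13-group, it
    is generated by a Singer cycle. If all of 2, 3 and 13 divide the order of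
    M, counting Sylow 13-subgroups shows that M contains all those of G; these
    generate G. Comparing orders, and checking that a frame stabilizer fixes
    neither a point nor a line, shows that the conjugates of the four subgroups
    are exactly the maximal subgroups ([maximalP]).

    Solubilizers. The four subgroups are soluble and G is not, so <x, y> is
    soluble exactly when x and y lie in a common maximal subgroup
    ([Sol_maximals]). For each of the seven representatives the conjugates of
    the four subgroups that contain it are listed, and the elements of their
    union are counted ([table_check]).

    Isomorphism types. The line stabilizer is AGL(2,3), written in block
    matrices; the inverse transpose exchanges points and lines; the normalizer
    of a Singer cycle has the presentation of the Frobenius group of order 39;
    and the frame stabilizer is the image of S_4 acting, up to sign, on the
    vectors of sum zero in its permutation module. *)

(** * Matrices of degree 3 over the field with three elements *)

(** The elements 0, 1 and -1 of the field, as a plain enumeration, so that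
    closed terms built on it reduce to values. *)
Inductive trit := Z0 | P1 | N1.

Definition tadd a b := match a, b with
  | Z0, c | c, Z0 => c | P1, P1 => N1 | N1, N1 => P1 | _, _ => Z0 end.
Definition topp a := match a with Z0 => Z0 | P1 => N1 | N1 => P1 end.
Definition tmul a b := match a with Z0 => Z0 | P1 => b | N1 => topp b end.
Definition teq a b :=
  match a, b with Z0, Z0 | P1, P1 | N1, N1 => true | _, _ => false end.

Inductive vec := V3 (a b c : trit).

Definition vadd v w := let: V3 a b c := v in let: V3 d e f := w in
  V3 (tadd a d) (tadd b e) (tadd c f).
Definition vscale s v := match s, v with
  | Z0, _ => V3 Z0 Z0 Z0 | P1, _ => v
  | N1, V3 a b c => V3 (topp a) (topp b) (topp c) end.
Definition vdot v w := let: V3 a b c := v in let: V3 d e f := w in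
  tadd (tmul a d) (tadd (tmul b e) (tmul c f)).
Definition tsub a b := tadd a (topp b).
Definition vcross v w := let: V3 a b c := v in let: V3 d e f := w in
  V3 (tsub (tmul b f) (tmul c e)) (tsub (tmul c d) (tmul a f))
     (tsub (tmul a e) (tmul b d)).
Definition veq v w := let: V3 a b c := v in let: V3 d e f := w in
  [&& teq a d, teq b e & teq c f].

Inductive mat := M3 (u v w : vec).

Definition mtr m :=
  let: M3 (V3 a b c) (V3 d e f) (V3 g h i) := m in
  M3 (V3 a d g) (V3 b e h) (V3 c f i).
Definition vact v m := let: V3 a b c := v in let: M3 p q r := m in
  vadd (vscale a p) (vadd (vscale b q) (vscale c r)).
Definition mmul m n := let: M3 p q r := m in M3 (vact p n) (vact q n) (vact r n).
Definition mdet m := let: M3 p q r := m in vdot p (vcross q r).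
(** Cramer's rule for determinant 1: the columns of the inverse are the cross
    products of the rows. *)
Definition minv m := let: M3 p q r := m in
  mtr (M3 (vcross q r) (vcross r p) (vcross p q)).
Definition meq m n := let: M3 p q r := m in let: M3 s t u := n in
  [&& veq p s, veq q t & veq r u].
Definition mone := M3 (V3 P1 Z0 Z0) (V3 Z0 P1 Z0) (V3 Z0 Z0 P1).

Lemma teqP : Equality.axiom teq. Proof. by do 2!case; constructor. Qed.
HB.instance Definition _ := hasDecEq.Build trit teqP.

Lemma veqP : Equality.axiom veq.
Proof.
case=> a b c [d e f]; apply: (iffP and3P) => [[/teqP-> /teqP-> /teqP-> //]|].
by case=> -> -> ->; split; apply/teqP.
Qed.
HB.instance Definition _ := hasDecEq.Build vec veqP.

Lemma meqP : Equality.axiom meq.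
Proof.
case=> a b c [d e f]; apply: (iffP and3P) => [[/veqP-> /veqP-> /veqP-> //]|].
by case=> -> -> ->; split; apply/veqP.
Qed.
HB.instance Definition _ := hasDecEq.Build mat meqP.

Definition trits := [:: Z0; P1; N1].
Definition vecs := [seq V3 ab.1 ab.2 c | ab <- [seq (a, b) | a <- trits, b <- trits], c <- trits].
Definition sl3 :=
  [seq m <- [seq M3 pq.1 pq.2 r | pq <- [seq (p, q) | p <- vecs, q <- vecs], r <- vecs]
  | teq (mdet m) P1].

Lemma mem_vecs v : v \in vecs. Proof. by case: v; do 3!case. Qed.

Lemma mem_sl3 m : (m \in sl3) = (mdet m == P1).
Proof.
rewrite mem_filter; case: m => p q r; rewrite andb_idr // => _.
by apply/allpairsP; exists ((p, q), r); rewrite !mem_vecs allpairs_f ?mem_vecs.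
Qed.

Lemma uniq_sl3 : uniq sl3.
Proof.
apply/filter_uniq/allpairs_uniq; [by vm_compute | by vm_compute |].
by move=> [[a b] c] [[d e] f] _ _ [-> -> ->].
Qed.

Definition Fof t : F3 := match t with Z0 => 0%R | P1 => 1%R | N1 => (-1)%R end.
Definition ofF (x : F3) := if x == 0%R then Z0 else if x == 1%R then P1 else N1.

Lemma FofK : cancel Fof ofF. Proof. by case. Qed.
Lemma ofFK : cancel ofF Fof.
Proof. by case=> [[|[|[|m]]] ltm] //; apply/eqP. Qed.
Lemma FofD a b : Fof (tadd a b) = (Fof a + Fof b)%R.
Proof. by apply/eqP; case: a; case: b. Qed.
Lemma FofN a : Fof (topp a) = (- Fof a)%R.
Proof. by apply/eqP; case: a. Qed.
Lemma FofM a b : Fof (tmul a b) = (Fof a * Fof b)%R.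
Proof. by apply/eqP; case: a; case: b. Qed.

Definition vent v (j : 'I_3) := let: V3 a b c := v in nth Z0 [:: a; b; c] j.
Definition mrow m (i : 'I_3) := let: M3 p q r := m in nth p [:: p; q; r] i.
Definition mx_of m : 'M[F3]_3 := \matrix_(i, j) Fof (vent (mrow m i) j).

Definition i0 : 'I_3 := @Ordinal 3 0 isT.
Definition i1 : 'I_3 := @Ordinal 3 1 isT.
Definition i2 : 'I_3 := @Ordinal 3 2 isT.

Lemma ord3P (P : 'I_3 -> Prop) : P i0 -> P i1 -> P i2 -> forall i, P i.
Proof.
move=> P0 P1 P2 [[|[|[|i]]] lti] //;
  [have := P0 | have := P1 | have := P2]; congr P; exact/val_inj.
Qed.

Lemma big_ord3 (F : 'I_3 -> F3) : (\sum_(i < 3) F i = F i0 + F i1 + F i2)%R.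
Proof.
rewrite !big_ord_recl big_ord0 GRing.addr0 GRing.addrA.
by congr (F _ + F _ + F _)%R; apply: val_inj.
Qed.

Definition code_mx (A : 'M[F3]_3) : mat :=
  let r i := V3 (ofF (A i i0)) (ofF (A i i1)) (ofF (A i i2)) in
  M3 (r i0) (r i1) (r i2).

Lemma code_mxK : cancel code_mx mx_of.
Proof.
move=> A; apply/matrixP=> i j; rewrite mxE.
by elim/ord3P: i; elim/ord3P: j; rewrite /= ofFK.
Qed.

Lemma mx_ofK : cancel mx_of code_mx.
Proof. by case=> [[a b c] [d e f] [g h i]]; rewrite /code_mx !mxE /= !FofK. Qed.

Lemma mx_of1 : mx_of mone = 1%:M%R.
Proof.
by apply/matrixP=> i j; rewrite !mxE; elim/ord3P: i; elim/ord3P: j.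
Qed.

Lemma Fof_vscale s v j : Fof (vent (vscale s v) j) = (Fof s * Fof (vent v j))%R.
Proof.
rewrite -FofM; congr (Fof _).
by case: s; case: v => a b c; elim/ord3P: j.
Qed.

Lemma Fof_vadd v w j : Fof (vent (vadd v w) j) = (Fof (vent v j) + Fof (vent w j))%R.
Proof. by rewrite -FofD; case: v => a b c; case: w => d e f; elim/ord3P: j. Qed.

Lemma mx_ofM m n : mx_of (mmul m n) = (mx_of m *m mx_of n)%R.
Proof.
apply/matrixP=> i j; rewrite !mxE big_ord3 !mxE.
have E v : (Fof (vent (vact v n) j) = Fof (vent v i0) * Fof (vent (mrow n i0) j) +
  Fof (vent v i1) * Fof (vent (mrow n i1) j) +
   Fof (vent v i2) * Fof (vent (mrow n i2) j))%R.
  by case: v n => a b c [p q r]; rewrite /vact !(Fof_vadd, Fof_vscale) GRing.addrA.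
by case: m => p q r; elim/ord3P: i; rewrite E.
Qed.

Lemma det_mx2 (A : 'M[F3]_2) :
  (\det A = A ord0 ord0 * A ord_max ord_max - A ord0 ord_max * A ord_max ord0)%R.
Proof.
rewrite (expand_det_row _ ord0) !big_ord_recl big_ord0 /cofactor !det_mx11 !mxE /=.
rewrite GRing.addr0 GRing.expr0 GRing.expr1 GRing.mul1r GRing.mulN1r GRing.mulrN.
by congr (_ * A _ _ - A _ _ * A _ _)%R; apply: val_inj.
Qed.

Lemma det_mx_of m : (\det (mx_of m))%R = Fof (mdet m).
Proof.
case: m => [[a b c] [d e f] [g h i]].
rewrite (expand_det_row _ i0) big_ord3 /cofactor !det_mx2 !mxE /=.
rewrite !(FofD, FofM, FofN) !add0n GRing.expr0 GRing.expr1 GRing.sqrrN GRing.expr1n.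
by rewrite GRing.mulN1r !GRing.mul1r GRing.opprB GRing.addrA.
Qed.

(** The entries of m times [minv m] are determinants of triples of rows of m. *)
Lemma mmul_minv : all (fun m => meq (mmul m (minv m)) mone) sl3.
Proof. by vm_compute. Qed.

(** * Cyclic subgroups up to conjugacy *)

(** Each conjugate of <x> has as many generators as <x>, and distinct
    conjugates have no common generator. *)
Lemma card_cycle_class (gT : finGroupType) (K : {group gT}) (x : gT) :
  #|[set y | <[y]> \in <[x]> :^: K]| = (#|K : 'N_K(<[x]>)| * totient #[x])%N.
Proof.
rewrite -card_conjugates -sum_nat_const -sum1_card.
rewrite (partition_big (fun y => <[y]>) (mem (<[x]> :^: K))) => [|y]; last by rewrite inE.
apply: eq_bigr => H clH; have [g _ defH] := imsetP clH.
rewrite -(orderJ x g) totient_gen -sum1_card; apply: eq_bigl => y.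
rewrite !inE /generator cycleJ -defH [RHS]eq_sym andb_idl // => /eqP->.
exact: clH.
Qed.

Lemma card_norm_conj (gT : finGroupType) (K : {group gT}) (A : {set gT}) g :
  g \in K -> #|'N_K(A :^ g)| = #|'N_K(A)|.
Proof. by move=> Kg; rewrite normJ -{1}(conjGid Kg) -conjIg cardJg. Qed.

Lemma order_exact (gT : finGroupType) (x : gT) n : (0 < n)%N -> x ^+ n = 1 ->
  (forall k, (0 < k < n)%N -> x ^+ k <> 1) -> #[x] = n.
Proof.
move=> n0 xn1 xk; apply/eqP; rewrite eqn_leq dvdn_leq ?order_dvdn ?xn1 //=.
by case: leqP => // lt_xn; case: (xk #[x]); rewrite ?order_gt0 ?expg_order.
Qed.

Fixpoint mpow m n := if n is n'.+1 then mmul m (mpow m n') else mone.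
Definition powers m n := [seq mpow m k | k <- iota 0 n].
Definition mconj g x := mmul (mmul g x) (minv g).
(** With ps the powers of x, this says that g normalizes <x>: g x = p g
    for some power p, which avoids the inverse of g. *)
Definition mnorm ps x g := has (fun p => meq (mmul g x) (mmul p g)) ps.
Definition has_morder m n :=
  meq (mpow m n) mone && all (fun k => ~~ meq (mpow m k) mone) (iota 1 n.-1).

Definition diagm a b c := M3 (V3 a Z0 Z0) (V3 Z0 b Z0) (V3 Z0 Z0 c).
Definition inv2 := diagm P1 N1 N1.
Definition transv3 := M3 (V3 P1 Z0 Z0) (V3 Z0 P1 Z0) (V3 P1 Z0 P1).
Definition regunip3 := M3 (V3 P1 P1 Z0) (V3 Z0 P1 P1) (V3 Z0 Z0 P1).
Definition elt4 := M3 (V3 P1 Z0 Z0) (V3 Z0 Z0 P1) (V3 Z0 N1 Z0).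
Definition elt6 := M3 (V3 P1 Z0 Z0) (V3 Z0 N1 N1) (V3 Z0 Z0 N1).
Definition elt8 := M3 (V3 N1 Z0 Z0) (V3 Z0 Z0 P1) (V3 Z0 P1 P1).
Definition singer := M3 (V3 Z0 P1 Z0) (V3 Z0 Z0 P1) (V3 P1 Z0 N1).

(** Generators of cyclic subgroups of the seven classes: an involution, a
    transvection, a regular unipotent element, elements of orders 4, 6 and 8,
    and a Singer cycle. *)
Definition reps := [:: inv2; transv3; regunip3; elt4; elt6; elt8; singer].
(** The order of each representative r and the order of the normalizer of
    <r>. These pairs are distinct although two of the orders agree. *)
Definition rep_data := [:: (2, 48); (3, 108); (3, 18); (4, 16); (6, 12); (8, 16); (13, 39)].

Definition rep i := nth mone reps i.
Definition rep_order i := (nth (0, 0) rep_data i).1.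
Definition rep_norm i := (nth (0, 0) rep_data i).2.

Lemma reps_check : all (fun i => [&& teq (mdet (rep i)) P1,
   0 < rep_order i, has_morder (rep i) (rep_order i) &
   count (mnorm (powers (rep i) (rep_order i)) (rep i)) sl3 == rep_norm i])%N (iota 0 7).
Proof. by vm_compute. Qed.

Lemma mmulA : associative mmul.
Proof. by move=> a b c; apply: (can_inj mx_ofK); rewrite !mx_ofM mulmxA. Qed.
Lemma mmul1 : right_id mone mmul.
Proof. by move=> a; apply: (can_inj mx_ofK); rewrite mx_ofM mx_of1 mulmx1. Qed.

Lemma mdet_mmul m n : mdet (mmul m n) = tmul (mdet m) (mdet n).
Proof. by apply: (can_inj FofK); rewrite FofM -!det_mx_of mx_ofM det_mulmx. Qed.

(** An identification of G with the matrices of determinant 1. The argument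
    needs nothing else of G, so that it applies to the quotient PSL(3,3) as
    it does to SL(3,3), whose centre it shows to be trivial. *)
Record coordinates (gT : finGroupType) (G : {group gT}) := Coordinates {
  code : gT -> mat;
  codeM : {in G &, {morph code : u v / u * v >-> mmul u v}};
  code_inj : {in G &, injective code};
  code_sl3 : {in G, forall u, code u \in sl3};
  code_surj : {in sl3, forall m, exists2 u, u \in G & code u = m}
}.

Arguments codeM {gT G c}.
Arguments code_inj {gT G c}.
Arguments code_sl3 {gT G c}.
Arguments code_surj {gT G}.

Section Coordinates.

Variables (gT : finGroupType) (G : {group gT}) (c : coordinates G).
Local Notation code := (code c).

Definition elt m : gT := odflt 1 [pick u in G | code u == m].

Lemma eltP m : m \in sl3 -> elt m \in G /\ code (elt m) = m.
Proof.
move=> m3; rewrite /elt; case: pickP => [u /andP[Gu /eqP] // | no].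
by have [u Gu Eu] := code_surj c _ m3; have := no u; rewrite Gu Eu eqxx.
Qed.

Lemma elt_in m : m \in sl3 -> elt m \in G. Proof. by case/eltP. Qed.
Lemma eltK m : m \in sl3 -> code (elt m) = m. Proof. by case/eltP. Qed.

Lemma all_sl3 (p : pred mat) : all p sl3 -> {in G, forall u, p (code u)}.
Proof. by move/allP=> pP u /code_sl3/pP. Qed.

(** The code of 1 is idempotent and invertible. *)
Lemma code1 : code 1 = mone.
Proof.
have E: code 1 = mmul (code 1) (code 1) by rewrite -codeM ?mulg1.
have /(congr1 (mmul^~ (minv (code 1)))) := E.
rewrite (meqP _ _ (all_sl3 mmul_minv (group1 G))).
by move=> ->; rewrite -mmulA (meqP _ _ (all_sl3 mmul_minv (group1 G))) mmul1.
Qed.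

Lemma codeV u : u \in G -> code u^-1 = minv (code u).
Proof.
move=> Gu; have E := meqP _ _ (all_sl3 mmul_minv Gu).
have di : minv (code u) \in sl3.
  have := code_sl3 (c := c) _ Gu; rewrite !mem_sl3 => /eqP du.
  by move/(congr1 mdet): E; rewrite mdet_mmul du /= => ->.
have [Gi Ei] := eltP di; rewrite -Ei; congr code; apply: (mulgI u).
apply: (code_inj (c := c)); rewrite ?groupM ?groupV //.
by rewrite mulgV codeM // Ei E code1.
Qed.

(** This turns each cardinal into the count of a closed list. *)
Lemma card_sl3 (p : pred mat) : #|[set u in G | p (code u)]| = count p sl3.
Proof.
set A := [set u in G | _].
have AG u : u \in A -> u \in G by rewrite inE => /andP[].
rewrite cardE -(size_map code) -size_filter; apply/perm_size/uniq_perm.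
- rewrite map_inj_in_uniq ?enum_uniq // => u v; rewrite !mem_enum => /AG Gu /AG Gv.
  exact: code_inj.
- by rewrite filter_uniq ?uniq_sl3.
move=> m; rewrite mem_filter; apply/mapP/andP => [[u]|[pm m3]].
  by rewrite mem_enum inE => /andP[Gu pu] ->; rewrite (code_sl3 _ Gu).
by exists (elt m); rewrite ?eltK // mem_enum inE elt_in ?eltK.
Qed.

Lemma card_G : #|G| = 5616.
Proof.
have <-: count xpredT sl3 = 5616 by apply/eqP; vm_compute.
by rewrite -card_sl3; apply: eq_card => u; rewrite !inE andbT.
Qed.

Lemma codeX u n : u \in G -> code (u ^+ n) = mpow (code u) n.
Proof.
by move=> Gu; elim: n => [|n IH]; rewrite ?code1 // expgS codeM ?groupX // IH.
Qed.

Lemma code_conj u x : u \in G -> x \in G ->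
  code (x ^ u^-1) = mconj (code u) (code x).
Proof.
by move=> Gu Gx; rewrite conjgE invgK mulgA /mconj -codeV // -!codeM ?groupM ?groupV.
Qed.

Lemma morder_code u n : u \in G -> (0 < n)%N -> has_morder (code u) n = (#[u] == n).
Proof.
move=> Gu n0; apply/andP/eqP => [[/meqP un1 /allP uk] | un]; last first.
  rewrite -codeX // -un expg_order code1; split; first exact/meqP.
  apply/allP=> k; rewrite mem_iota add1n prednK // -codeX // -code1 => /andP[k0 kn].
  apply/meqP=> /code_inj; rewrite groupX // => /(_ isT (group1 G))/eqP.
  by rewrite -order_dvdn => /(dvdn_leq k0); rewrite leqNgt kn.
apply: order_exact => //.
  by apply: (code_inj (c := c)); rewrite ?groupX // codeX // code1.
move=> k /andP[k0 kn] uk1; have := uk k; rewrite mem_iota k0 add1n prednK // kn.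
by rewrite -codeX // uk1 code1 => /(_ isT)/meqP[].
Qed.

Lemma norm_cycle_code x u n : u \in G -> x \in G -> #[x] = n ->
  (u \in 'N(<[x]>)) = mnorm (powers (code x) n) (code x) (code u).
Proof.
move=> Gu Gx oxn; rewrite -groupV -cycle_subG norms_cycle conjgE invgK mulgA.
apply/idP/hasP => [/cyclePmin[k ltk Ek] | [p /mapP[k ltk ->]]].
  exists (mpow (code x) k); first by apply: map_f; rewrite mem_iota -oxn.
  apply/meqP; rewrite -codeX // -!codeM ?groupX //; congr code.
  by rewrite -Ek mulgKV.
move/meqP; rewrite -codeX // -!codeM ?groupX // => /code_inj->.
- by rewrite mulgK mem_cycle.
- by rewrite groupM.
by rewrite groupM ?groupX.
Qed.

Lemma card_norm_cycle x n : x \in G -> #[x] = n ->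
  #|'N_G(<[x]>)| = count (mnorm (powers (code x) n) (code x)) sl3.
Proof.
move=> Gx oxn; rewrite -(card_sl3); apply: eq_card => u; rewrite !in_setI inE.
by case Gu: (u \in G); rewrite //= -(norm_cycle_code Gu Gx oxn).
Qed.

Lemma repP i : (i < 7)%N ->
  [/\ elt (rep i) \in G, code (elt (rep i)) = rep i, #[elt (rep i)] = rep_order i
    & #|'N_G(<[elt (rep i)]>)| = rep_norm i].
Proof.
move=> lti7; have i7: i \in iota 0 7 by rewrite mem_iota.
have /and4P[dr o0 oi ni] := allP reps_check i i7.
have r3: rep i \in sl3 by rewrite mem_sl3.
have [Gr cr] := eltP r3.
have orn: #[elt (rep i)] = rep_order i by apply/eqP; rewrite -morder_code ?cr.
by split=> //; rewrite (card_norm_cycle Gr orn) cr; apply/eqP.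
Qed.

(** The seven classes contribute 117, 104, 624, 702, 936, 1404 and 1728
    elements; the sum is 5615, the number of nontrivial elements of G. *)
Lemma cycle_conj_rep x : x \in G -> x != 1 ->
  exists2 i, (i < 7)%N & <[x]> \in <[elt (rep i)]> :^: G.
Proof.
pose C (i : 'I_7) := [set y | <[y]> \in <[elt (rep i)]> :^: G].
suffices defG: \bigcup_i C i = G^#.
  move=> Gx ntx; have: x \in G^# by rewrite in_setD1 ntx.
  by rewrite -defG => /bigcupP[i _]; rewrite inE; exists i.
have CsubG: \bigcup_i C i \subset G^#.
  apply/bigcupsP=> i _; apply/subsetP=> y; rewrite inE => /imsetP[g Gg Ey].
  have [Gr _ on _] := repP (ltn_ord i).
  have Gy: y \in G by rewrite -cycle_subG Ey -cycleJ cycle_subG groupJ.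
  rewrite in_setD1 Gy andbT -order_gt1 orderE Ey -cycleJ -orderE orderJ on.
  by case: i {Gr on Ey} => i; do 7!case: i => [|i] //.
have oG1: #|G^#| = 5615.
  have E := cardsD1 1 G; rewrite group1 card_G in E.
  by apply/eqP; rewrite -(eqn_add2l 1) -[(1 + #|_|)%N]E; vm_compute.
apply/eqP; rewrite eqEcard CsubG oG1.
rewrite -sum1_card partition_disjoint_bigcup; last first.
  move=> i j; apply: contraR; rewrite -setI_eq0 => /set0Pn[y].
  rewrite !inE => /andP[/imsetP[g Gg Ei] /imsetP[h Gh Ej]].
  have [Gi _ oi ni] := repP (ltn_ord i); have [Gj _ oj nj] := repP (ltn_ord j).
  (* conjugate subgroups have equal orders and normalizers of equal orders *)
  apply/eqP/val_inj/eqP; rewrite /= -(nth_uniq (0, 0)%N (s := rep_data)) //.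
  rewrite -pair_eqE /pair_eq -/(rep_order i) -/(rep_order j).
  rewrite -/(rep_norm i) -/(rep_norm j) -oi -oj -ni -nj !orderE.
  rewrite -(card_norm_conj _ Gg) -(card_norm_conj <[elt (rep j)]> Gh).
  by rewrite -(cardJg <[elt (rep i)]> g) -(cardJg <[elt (rep j)]> h) -Ei -Ej !eqxx.
rewrite (eq_bigr (fun i : 'I_7 => (5616 %/ rep_norm i * totient (rep_order i))%N)).
  by rewrite !big_ord_recl big_ord0.
move=> i _; have [Gi _ oi ni] := repP (ltn_ord i).
by rewrite sum1_card card_cycle_class -divgS ?subsetIl // oi ni card_G.
Qed.

(** All elements of an order that occurs once in the list of representatives
    generate conjugate subgroups: this covers the orders 2 and 13. *)
Lemma order_conj_rep i x :
    all (fun j => (rep_order j == rep_order i) ==> (j == i)) (iota 0 7) ->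
    (1 < rep_order i)%N -> x \in G -> #[x] = rep_order i ->
  <[x]> \in <[elt (rep i)]> :^: G.
Proof.
move=> /allP uniq_i oi Gx ox.
have [|j ltj7 cx] := cycle_conj_rep Gx; first by rewrite -order_gt1 ox.
suffices /eqP <-: j == i by [].
have j7: j \in iota 0 7 by rewrite mem_iota.
apply: (implyP (uniq_i j j7)); have [_ _ <- _] := repP ltj7.
by have [g _ Ex] := imsetP cx; rewrite -ox !orderE Ex cardJg.
Qed.

End Coordinates.

(** * Four subgroups *)

Definition isdiag m := let: M3 (V3 a _ _) (V3 _ b _) (V3 _ _ c) := m in
  meq m (diagm a b c).
Definition diags := [:: mone; diagm P1 N1 N1; diagm N1 P1 N1; diagm N1 N1 P1].
(** For a row of an invertible matrix, that exactly one entry is nonzero. *)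
Definition unitv v := match v with
  | V3 Z0 Z0 _ | V3 Z0 _ Z0 | V3 _ Z0 Z0 => true | _ => false end.
Definition monom m := let: M3 p q r := m in [&& unitv p, unitv q & unitv r].

Inductive kind := Point | Line | Singer | Frame.
Definition eqk k l := match k, l with
  | Point, Point | Line, Line | Singer, Singer | Frame, Frame => true
  | _, _ => false end.
Lemma eqkP : Equality.axiom eqk. Proof. by do 2!case; constructor. Qed.
HB.instance Definition _ := hasDecEq.Build kind eqkP.

Definition singers := powers singer 13.
(** Matrices act on row vectors from the right. The four cases are the
    stabilizer of the line through the first basis vector, the stabilizer of
    the plane spanned by the first two, the normalizer of the Singer cycle,
    and the monomial matrices, which permute the three coordinate axes. *)
Definition in_std k m := match k with
  | Point => let: M3 (V3 _ b c) _ _ := m in teq b Z0 && teq c Z0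
  | Line => let: M3 (V3 _ _ c) (V3 _ _ f) _ := m in teq c Z0 && teq f Z0
  | Singer => mnorm singers singer m
  | Frame => monom m end.

Lemma isdiag_diags : all (fun m => isdiag m ==> (m \in diags)) sl3.
Proof. by vm_compute. Qed.

(** The axes are the common eigenspaces of the diagonal group, and they
    carry distinct characters, so the normalizer of this group permutes them. *)
Lemma monom_norm : all (fun m => all (fun d => isdiag (mconj m d)) diags == monom m) sl3.
Proof. by vm_compute. Qed.

Lemma triangular_closed k m n : k \in [:: Point; Line] ->
  in_std k m -> in_std k n -> in_std k (mmul m n).
Proof.
rewrite !inE => /orP[] /eqP->.
  case: m n => [[a [] []] q r] [[a' [] []] q' r'] //; by case: a; case: a'.
case: m n => [[a b []] [d e []] r] [[a' b' []] [d' e' []] r'] //.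
by case: a; case: b; case: d; case: e; case: r' => f [] [].
Qed.

Definition kinds := [:: Point; Line; Singer; Frame].
Definition kind_order k := match k with
  | Point | Line => 432 | Singer => 39 | Frame => 24 end.
Lemma count_kind : all (fun k => count (in_std k) sl3 == kind_order k) kinds.
Proof. by vm_compute. Qed.

(** Each representative r becomes an element of order 13 when it is
    multiplied by a suitable conjugate of the Singer cycle s: so r lies in
    every normal subgroup that contains s ([normal_singer]). *)
Lemma order13_products : all (fun i => has (fun g =>
  has_morder (mmul (rep i) (mconj g singer)) 13) sl3) (iota 0 7).
Proof. by lazy. Qed.

(** The automorphism that cubes the elements of <s> is induced by an element
    of order 3, which exhibits both s as a product of commutators and the
    presentation of the normalizer of <s>. *)
Lemma singer_cube : has (fun g =>
  meq (mconj g singer) (mpow singer 3) && meq (mpow g 3) mone) sl3.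
Proof. by lazy. Qed.

Section Subgroups.

Variables (gT : finGroupType) (G : {group gT}) (c : coordinates G).
Local Notation code := (code c).
Local Notation elt := (elt c).
Local Notation s := (elt singer).

Lemma singerP : [/\ s \in G, code s = singer, #[s] = 13 & #|'N_G(<[s]>)| = 39].
Proof. exact: (repP c (isT : 6 < 7)%N). Qed.

Definition diag_set := [set u in G | isdiag (code u)].
Lemma mem_diag u : u \in G -> (u \in diag_set) = (code u \in diags).
Proof.
move=> Gu; rewrite inE Gu; have := all_sl3 c isdiag_diags Gu.
case di: (isdiag _) => //= _; apply/esym/negbTE; apply: contraFN di.
by rewrite !inE => /or4P[] /eqP->.
Qed.

Lemma norm_diag u : u \in G -> (u \in 'N(diag_set)) = monom (code u).
Proof.
move=> Gu; rewrite -(eqP (all_sl3 c monom_norm Gu)) -groupV inE.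
apply/subsetP/allP => [nE d dd | nE _ /imsetP[x Ex ->]].
  have d3: d \in sl3 by rewrite mem_sl3; move: dd; rewrite !inE => /or4P[] /eqP->.
  have [Gd Ed] := eltP c d3; have: elt d ^ u^-1 \in diag_set.
    by rewrite nE // memJ_conjg mem_diag ?Ed.
  by rewrite inE code_conj // Ed => /andP[].
have Gx: x \in G by move: Ex; rewrite inE => /andP[].
by rewrite inE groupJ ?groupV //= code_conj // nE // -mem_diag.
Qed.

Definition std_set k := [set u in G | in_std k (code u)].

Lemma std_set_Singer : std_set Singer = 'N_G(<[s]>).
Proof.
have [Gs cs os _] := singerP; apply/setP=> u; rewrite in_setI inE.
by case Gu: (u \in G); rewrite // (norm_cycle_code c Gu Gs os) cs.
Qed.

Lemma std_set_Frame : std_set Frame = 'N_G(diag_set).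
Proof.
apply/setP=> u; rewrite in_setI inE.
by case Gu: (u \in G); rewrite // norm_diag.
Qed.

Lemma std_set_group k : group_set (std_set k).
Proof.
have [tri|] := boolP (k \in [:: Point; Line]); last first.
  by case: k => // _; rewrite (std_set_Singer, std_set_Frame) groupP.
apply/group_setP; split=> [|u v].
  by rewrite inE group1 code1; case: k tri.
rewrite !inE => /andP[Gu Au] /andP[Gv Av].
by rewrite groupM // codeM // triangular_closed.
Qed.
Canonical std_group k := Group (std_set_group k).
Definition std k : {group gT} := std_group k.

Lemma mem_std k u : u \in G -> (u \in std k) = in_std k (code u).
Proof. by rewrite inE => ->. Qed.

Lemma sub_std k : std k \subset G.
Proof. by apply/subsetP=> u; rewrite inE => /andP[]. Qed.

Lemma card_std k : #|std k| = kind_order k.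
Proof.
rewrite card_sl3; apply/eqP; apply: (allP count_kind).
by case: k.
Qed.

Lemma order13 y : y \in G -> #[y] = 13 -> <[y]> \in <[s]> :^: G.
Proof. exact: (@order_conj_rep _ _ c 6). Qed.

(** N contains all elements of order 13, as these generate conjugates of <s>;
    then it contains all representatives, by [order13_products], and all
    elements. *)
Lemma normal_singer (N : {group gT}) : N <| G -> s \in N -> N :=: G.
Proof.
case/andP=> sNG nNG Ns; apply/eqP; rewrite eqEsubset sNG.
have cyc x y : y \in N -> <[x]> \in <[y]> :^: G -> x \in N.
  move=> Ny /imsetP[g Gg Ex]; have: x \in <[y]> :^ g by rewrite -Ex cycle_id.
  by apply/subsetP; rewrite -(normsP nNG g Gg) conjSg cycle_subG.
have [Gs cs os _] := singerP.
apply/subsetP=> x Gx; have [->|ntx] := eqVneq x 1; first exact: group1.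
have [i lti7 /cyc-> //] := cycle_conj_rep c Gx ntx.
have [Gr cr _ _] := repP c lti7.
have i7: i \in iota 0 7 by rewrite mem_iota.
have /hasP[m m3] := allP order13_products i i7.
have [Gm cm] := eltP c m3.
rewrite -cr -cm -cs -code_conj // -codeM ?groupJ ?groupV //.
rewrite morder_code ?groupM ?groupJ ?groupV //.
move/eqP/order13; rewrite groupM ?groupJ ?groupV // => /(_ isT) /(cyc _ _ Ns).
have Nsg: s ^ (elt m)^-1 \in N by rewrite memJ_norm // (subsetP nNG) ?groupV.
by rewrite cr groupMr.
Qed.

(** If y cubes s then [s, y] = s ^ 2 generates <s>, so the derived group
    contains s and is G. *)
Lemma not_solvable : ~~ solvable G.
Proof.
have [Gs cs os _] := singerP.
have ntG: G :!=: 1 by apply/trivgPn; exists s; rewrite // -order_gt1 os.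
apply/negP=> solG; have := sol_der1_proper solG (subxx G) ntG.
rewrite properE => /andP[_ /negP]; apply.
suffices Ds: s \in G^`(1) by rewrite /= (@normal_singer (G^`(1))%G) ?der_normal.
have /hasP[m m3 /andP[/meqP + _]] := singer_cube; have [Gm cm] := eltP c m3.
rewrite -cm -cs -code_conj // -codeX // => /code_inj E.
have: [~ s, (elt m)^-1] \in [~: G, G] by rewrite mem_commg ?groupV.
rewrite commgEl E ?groupJ ?groupV ?groupX // expgS mulKg => /(groupX 7).
(* the seventh power of s ^ 2 is s ^ 14 = s *)
have s13: s ^+ 13 = 1 by rewrite -os expg_order.
by rewrite -expgM (_ : 2 * 7 = 13 + 1)%N // expgD s13 mul1g cs.
Qed.

End Subgroups.

(** * The natural representation *)

Lemma ofF0 : ofF 0%R = Z0. Proof. by []. Qed.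

Lemma F3_sqr (a : F3) : (a != 0 -> a * a = 1)%R.
Proof. by rewrite -[a]ofFK -FofM; case: (ofF a). Qed.

Lemma det_normalize (B : 'M[F3]_3) : B \in unitmx -> (\det ((\det B)%R *: B) = 1)%R.
Proof.
rewrite unitmxE GRing.unitfE => dB0; rewrite detZ GRing.exprS GRing.expr2.
by rewrite -!GRing.mulrA F3_sqr // GRing.mulr1 F3_sqr.
Qed.

Section Representation.

Variables (gT : finGroupType) (G : {group gT}) (c : coordinates G).
Local Notation code := (code c).
Local Notation elt := (elt c).
Local Notation std := (std c).

Definition natural_mx u := mx_of (code u).

Lemma natural_mx_repr : mx_repr G natural_mx.
Proof.
split=> [|u v Gu Gv]; first by rewrite /natural_mx code1 mx_of1.
by rewrite /natural_mx codeM // mx_ofM.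
Qed.
Canonical natural_repr := MxRepresentation natural_mx_repr.
Local Notation rG := natural_repr.

Lemma natural_repr_inj : {in G &, injective rG}.
Proof. by move=> u v Gu Gv /(can_inj mx_ofK)/code_inj->. Qed.

(** In degree 3 the scalar -1 has determinant -1, so exactly one of B and -B
    has determinant 1; it is B multiplied by its determinant. This is a
    morphism from the invertible matrices onto G. *)
Definition proj_lift (B : 'M[F3]_3) := elt (code_mx ((\det B)%R *: B)%R).

Lemma proj_liftP B : B \in unitmx ->
  proj_lift B \in G /\ rG (proj_lift B) = ((\det B) *: B)%R.
Proof.
move=> uB; have m3: code_mx ((\det B)%R *: B) \in sl3.
  by rewrite mem_sl3 -(can_eq FofK) -det_mx_of code_mxK det_normalize.
have [Gg cg] := eltP c m3; split=> //.
by rewrite -[LHS]/(mx_of (code (elt (code_mx _)))) cg code_mxK.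
Qed.

Lemma proj_liftM B C : B \in unitmx -> C \in unitmx ->
  proj_lift (B *m C)%R = proj_lift B * proj_lift C.
Proof.
move=> uB uC; have [GB EB] := proj_liftP uB; have [GC EC] := proj_liftP uC.
have [|GBC EBC] := @proj_liftP (B *m C)%R; first by rewrite unitmx_mul uB.
apply: natural_repr_inj; rewrite ?groupM // repr_mxM // EBC EB EC.
by rewrite det_mulmx -scalemxAl -scalemxAr GRing.scalerA.
Qed.

Lemma proj_lift_inj B C : B \in unitmx -> C \in unitmx ->
  proj_lift B = proj_lift C -> ((\det B) *: B = (\det C) *: C)%R.
Proof.
by move=> uB uC E; have [_ <-] := proj_liftP uB; have [_ <-] := proj_liftP uC; rewrite E.
Qed.

(** The sign introduced by [proj_lift] cancels in a conjugation. *)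
Lemma change_basis (B : 'M[F3]_3) : B \in unitmx -> exists2 g, g \in G &
  forall u, u \in G -> (rG (u ^ g^-1)%g = B *m rG u *m invmx B)%R.
Proof.
move=> uB; have [Gg Eg] := proj_liftP uB; exists (proj_lift B) => // u Gu.
rewrite conjgE invgK !repr_mxM ?groupM ?groupV // mulmxA repr_mxV // Eg.
have d0: (\det B \is a GRing.unit)%R by rewrite -unitmxE.
rewrite invmxZ; last by rewrite unitmxZ.
by rewrite -!scalemxAl -scalemxAr GRing.scalerA GRing.mulrV // GRing.scale1r.
Qed.

Lemma diag_repr u : u \in G -> is_diag_mx (rG u) -> u \in diag_set c.
Proof.
rewrite inE => -> /is_diag_mxP /= E.
rewrite -[code u]mx_ofK -/(natural_mx u) /code_mx /=.
rewrite (E i0 i1) // (E i0 i2) // (E i1 i0) // (E i1 i2) // (E i2 i0) // (E i2 i1) //.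
by rewrite ofF0; case: (ofF (_ i0 i0)); case: (ofF (_ i1 i1)); case: (ofF (_ i2 i2)).
Qed.

Definition kind_of_rank r := if r == 1%N then Point else Line.

Lemma triangular_repr r u : u \in G -> r \in [:: 1; 2]%N ->
  (forall i j : 'I_3, (i < r <= j)%N -> (rG u i j = 0)%R) -> u \in std (kind_of_rank r).
Proof.
move=> Gu r12 E; rewrite mem_std // -[code u]mx_ofK -/(natural_mx u) /code_mx.
by move: r12 E; rewrite !inE => /orP[] /eqP-> /= E; rewrite !E // ofF0.
Qed.

Lemma row_ebase_sub m (U : 'M[F3]_(m, 3)) (i : 'I_3) :
  (i < \rank U)%N -> (row i (row_ebase U) <= U)%MS.
Proof.
move=> lti; rewrite -(eq_row_base U) /row_base.
suffices ->: (row i (row_ebase U) = row (Ordinal lti) (pid_mx (\rank U) *m row_ebase U))%R.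
  exact: row_sub.
rewrite row_mul [LHS]rowE; congr (_ *m _)%R; apply/rowP=> j.
by rewrite !mxE /= lti andbT -val_eqE eq_sym.
Qed.

(** In a basis of row vectors that begins with a basis of U the elements of
    M are block triangular. *)
Lemma stable_sub_std (M : {group gT}) m (U : 'M[F3]_(m, 3)) :
  M \subset rstabs rG U -> \rank U \in [:: 1; 2]%N ->
  exists2 g, g \in G & M \subset std (kind_of_rank (\rank U)) :^ g.
Proof.
move=> /subsetP MU r12; have [g Gg Eg] := change_basis (row_ebase_unit U).
exists g => //; apply/subsetP=> u /MU; rewrite !inE => /andP[Gu stabU].
rewrite mem_conjg; apply: triangular_repr; rewrite ?groupJ ?groupV // => i j /andP[ltir lerj].
rewrite Eg //; set C := (_ *m rG u *m _)%R.
have ->: (C i j = (row i C) 0 j)%R by rewrite [RHS]mxE.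
rewrite /C !row_mul.
have: ((row i (row_ebase U) *m rG u)%R <= row_base U)%MS.
  by rewrite eq_row_base (submx_trans _ stabU) // submxMr ?row_ebase_sub.
case/submxP=> X ->; rewrite /row_base mulmxA mulmxK ?row_ebase_unit // mxE big1 // => k _.
rewrite mxE; case: eqP => [Ek|_]; last by rewrite GRing.mulr0.
by have := ltn_ord k; rewrite Ek ltnNge lerj.
Qed.

End Representation.

(** * Overgroups of proper subgroups *)

(** The vectors fixed by the involution diag(1, -1, -1) are the multiples of
    the first basis vector, and the centralizer preserves this line. *)
Lemma norm_inv2_Point :
  all (fun m => mnorm (powers inv2 2) inv2 m ==> in_std Point m) sl3.
Proof. by vm_compute. Qed.

(** The polynomial (X - 1)(X + 1) has simple roots and annihilates B. *)
Lemma diagonalizable_involution (F : fieldType) n (B : 'M[F]_n.+1) :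
  (1 != -1 :> F)%R -> (B *m B = 1%:M)%R -> diagonalizable B.
Proof.
move=> ne BB; apply/diagonalizableP; exists [:: 1; -1]%R; first by rewrite /= inE ne.
apply: mxminpoly_min.
rewrite big_cons big_seq1 GRing.rmorphM !GRing.rmorphB /= !horner_mx_X !horner_mx_C.
rewrite GRing.raddfN /= GRing.opprK -GRing.subr_sqr_1 GRing.expr2.
by rewrite -[(B * B)%R]/(B *m B)%R BB GRing.subrr.
Qed.

Lemma primes_5616 : primes 5616 = [:: 2; 3; 13].
Proof. by apply/eqP; vm_compute. Qed.

Section Overgroups.

Variables (gT : finGroupType) (G : {group gT}) (c : coordinates G).
Local Notation code := (code c).
Local Notation elt := (elt c).
Local Notation std := (std c).
Local Notation s := (elt singer).
Local Notation rG := (natural_repr c).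

(** A 3-group fixes a nonzero vector in characteristic 3, and M preserves the
    space of fixed vectors of Q. This space is proper since Q acts
    nontrivially. *)
Lemma norm_3group_sub_std (M Q : {group gT}) :
  Q \subset G -> 3.-group Q -> Q :!=: 1 -> M \subset 'N_G(Q) ->
  exists k, exists2 g, g \in G & M \subset std k :^ g.
Proof.
move=> sQG pQ ntQ nQM; pose U := rfix_mx rG Q.
have sMU: M \subset rstabs rG U.
  exact: subset_trans nQM (norm_sub_rstabs_rfix_mx _ sQG).
have U0: (0 < \rank U)%N.
  by rewrite lt0n mxrank_eq0; apply: (@rfix_pgroup_pchar _ 3) => //; apply: pchar_Fp.
have U3: (\rank U < 3)%N.
  rewrite ltn_neqAle rank_leq_col andbT; apply: contra ntQ => fullU.
  rewrite -subG1; apply/subsetP=> q Qq; have Gq := subsetP sQG q Qq; rewrite inE; apply/eqP.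
  apply: (natural_repr_inj (c := c)); rewrite ?group1 // repr_mx1.
  have: (1%:M%R <= U)%MS by rewrite sub1mx.
  by move/rfix_mxP/(_ q Qq); rewrite mul1mx.
have r12: \rank U \in [:: 1; 2]%N by case: (\rank U) U0 U3 => [|[|[|]]].
by have [g Gg sM] := stable_sub_std sMU r12; exists (kind_of_rank (\rank U)), g.
Qed.

(** The order of G is 16 * 27 * 13, so Q has order 13. *)
Lemma norm_13group_sub_std (M Q : {group gT}) :
  Q \subset G -> 13.-group Q -> Q :!=: 1 -> M \subset 'N_G(Q) ->
  exists2 g, g \in G & [/\ M \subset std Singer :^ g & Q :=: <[s]> :^ g].
Proof.
move=> sQG pQ ntQ nQM; have [_ _ [n oQ]] := pgroup_pdiv pQ ntQ.
have oQ13: #|Q| = 13.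
  case: n oQ => [|n] oQ //.
  have := cardSg sQG; rewrite oQ (card_G c) => d.
  have : (13 ^ 2 %| 5616)%N by apply: dvdn_trans d; apply: dvdn_exp2l.
  by vm_compute.
have [x Qx] : exists x, Q :=: <[x]>.
  by apply/cyclicP/prime_cyclic; rewrite oQ13.
have Gx: x \in G by rewrite -cycle_subG -Qx.
have ox: #[x] = 13 by rewrite orderE -Qx.
have /imsetP[g Gg Eg] := order13 c Gx ox.
exists g => //; split; last by rewrite Qx.
rewrite (std_set_Singer c : std Singer = 'N_G(_) :> {set _}).
by rewrite conjIg conjGid // -normJ -Eg -Qx.
Qed.

(** Commuting diagonalizable matrices are diagonal in a common basis. *)
Lemma comm_involutions_diag (Q : {group gT}) :
  Q \subset G -> abelian Q -> {in Q, forall q, q ^+ 2 = 1} ->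
  exists2 g, g \in G & Q \subset diag_set c :^ g.
Proof.
move=> sQG abQ Q2; have GQ := subsetP sQG.
have [P uP /allP diagP]: codiagonalizable [seq rG q | q in Q].
  apply/codiagonalizableP; split.
    move=> _ _ /imageP[q Qq ->] /imageP[r Qr ->].
    by rewrite /comm_mx -!repr_mxM ?GQ // (centsP abQ).
  move=> _ /imageP[q Qq ->]; apply: diagonalizable_involution => //.
  by rewrite -repr_mxM ?GQ // -[(q * q)]/(q ^+ 2) Q2 // repr_mx1.
have [g Gg Eg] := change_basis c uP; exists g => //.
apply/subsetP=> q Qq; rewrite mem_conjg; have Gq := GQ q Qq.
apply: diag_repr; first by rewrite groupJ ?groupV.
by rewrite Eg // -conjumx //; apply: diagP; apply: map_f; rewrite mem_enum.
Qed.

(** Up to conjugacy Q is contained in the diagonal group, of order 4. If Q is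
    that group, M normalizes it. Otherwise Q has order 2, all involutions are
    conjugate, and M centralizes an involution. *)
Lemma norm_2group_sub_std (M Q : {group gT}) :
  Q \subset G -> 2.-abelem Q -> Q :!=: 1 -> M \subset 'N_G(Q) ->
  exists k, exists2 g, g \in G & M \subset std k :^ g.
Proof.
move=> sQG abQ ntQ nQM; have [pQ cQQ _] := and3P abQ.
have Q2 q : q \in Q -> q ^+ 2 = 1 by case/abelemP: abQ => // _; apply.
have [g Gg sQE] := comm_involutions_diag sQG cQQ Q2.
have [_ _ [n oQ]] := pgroup_pdiv pQ ntQ.
have oE: #|diag_set c| = 4 by rewrite card_sl3; apply/eqP; vm_compute.
case: n oQ => [|n] oQ.
  have [x Qx] : exists x, Q :=: <[x]> by apply/cyclicP/prime_cyclic; rewrite oQ.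
  have Gx: x \in G by rewrite -cycle_subG -Qx.
  have ox: #[x] = 2 by rewrite orderE -Qx oQ.
  have /imsetP[h Gh Ex] := @order_conj_rep _ _ c 0 x isT isT Gx ox.
  have [Gr cr or _] := repP c (isT : 0 < 7)%N.
  exists Point, h => //; apply: subset_trans nQM _.
  rewrite Qx Ex normJ -{1}(conjGid Gh) -conjIg conjSg; apply/subsetP=> u.
  case/setIP=> Gu; rewrite mem_std // (norm_cycle_code c Gu Gr or) cr.
  exact/implyP/(all_sl3 c norm_inv2_Point).
exists Frame, g => //; apply: subset_trans nQM _.
have ->: Q :=: diag_set c :^ g.
  by apply/eqP; rewrite eqEcard sQE cardJg oE oQ; apply: (@leq_pexp2l 2 2).
rewrite normJ -{1}(conjGid Gg) -conjIg conjSg.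
by rewrite (std_set_Frame c : std Frame = 'N_G(_) :> {set _}).
Qed.

(** Let n be the number of Sylow 13-subgroups of M and a = 13 or 39 the order
    of the normalizer in M of one of them. Then n a = |M| is a multiple of 78
    that divides 5616 and n is 1 modulo 13, which leaves n = 144 only. As
    <s> has 144 conjugates in G, they all lie in M, and they generate G. *)
Lemma three_primes_full (M : {group gT}) : M \subset G ->
  {subset [:: 2; 3; 13] <= primes #|M|} -> G \subset M.
Proof.
move=> sMG divM; have [Gs _ os on] := singerP c.
have syl13 P : P \in 'Syl_13(M) -> exists2 g, g \in G & P :=: <[s]> :^ g.
  rewrite inE => sylP; have [sPM pP _] := and3P sylP; have sPG := subset_trans sPM sMG.
  have ntP: P :!=: 1.
    rewrite -cardG_gt1 (card_Hall sylP) p_part -{1}(expn0 13) ltn_exp2l // logn_gt0.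
    by rewrite divM // !inE.
  have nPP: P \subset 'N_G(P) by rewrite subsetI sPG normG.
  by have [g Gg [_ ->]] := norm_13group_sub_std sPG pP ntP nPP; exists g.
have oSyl: #|'Syl_13(M)| = 144.
  have [P sylP] := Sylow_exists 13 M.
  have [|g Gg Pg] := @syl13 P; first by rewrite inE.
  have := card_Syl_mod M (isT : prime 13); rewrite (card_Syl sylP) -divgS ?subsetIl //.
  have a39: (#|'N_M(P)| %| 39)%N.
    by rewrite -on -(card_norm_conj _ Gg) -Pg cardSg ?setSI.
  have a13: (13 %| #|'N_M(P)|)%N.
    rewrite -os orderE -(cardJg _ g) -Pg cardSg // subsetI normG andbT.
    exact: pHall_sub sylP.
  have aM: (#|'N_M(P)| %| #|M|)%N by rewrite cardSg ?subsetIl.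
  have dM: #|M| \in divisors 5616 by rewrite -dvdn_divisors // -(card_G c) cardSg.
  have a2: #|'N_M(P)| \in [:: 13; 39]%N.
    have d39: divisors 39 = [:: 1; 3; 13; 39]%N by apply/eqP; vm_compute.
    have: #|'N_M(P)| \in divisors 39 by rewrite -dvdn_divisors.
    by move: a13; rewrite d39 !inE => + /or4P[] /eqP E; rewrite E.
  have d2 p : p \in [:: 2; 3; 13]%N -> (p %| #|M|)%N.
    by move/divM; rewrite mem_primes => /and3P[].
  move=> n1; apply/eqP; move: (d2 2 isT) (d2 3 isT) (d2 13 isT) aM n1.
  have: all (fun d => all (fun a => [&& 2 %| d, 3 %| d, 13 %| d, a %| d & (d %/ a) %% 13 == 1]
     ==> (d %/ a == 144)) [:: 13; 39])%N (divisors 5616) by vm_compute.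
  move/allP/(_ _ dM)/allP/(_ _ a2)/implyP => H h2 h3 h13 ha h1; apply: H.
  by rewrite h2 h3 h13 ha h1.
have allSyl: <[s]> :^: G = [set gval P | P in 'Syl_13(M)].
  apply/esym/eqP; rewrite eqEcard; apply/andP; split.
    by apply/subsetP=> _ /imsetP[P /syl13[g Gg ->] ->]; apply: imset_f.
  rewrite card_conjugates -divgS ?subsetIl // on (card_G c) card_imset ?oSyl //.
  exact: val_inj.
have clM: <<s ^: G>> \subset M.
  rewrite gen_subG; apply/subsetP=> _ /imsetP[g Gg ->].
  have: <[s]> :^ g \in <[s]> :^: G by apply: imset_f.
  rewrite allSyl => /imsetP[P]; rewrite inE => /pHall_sub sPM E.
  by apply: (subsetP sPM); rewrite -[gval P]E memJ_conjg cycle_id.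
rewrite -(_ : <<s ^: G>> = G :> {set _}) //.
apply: (@normal_singer _ _ c <<s ^: G>>%G); last by rewrite mem_gen ?class_refl.
rewrite /normal gen_subG class_subG ?subxx //=.
exact/norms_gen/class_norm.
Qed.

(** By the theorem of Burnside M is soluble unless three primes divide its
    order; a minimal normal subgroup of M is then elementary abelian, for one
    of the primes 2, 3 and 13. *)
Theorem proper_sub_std (M : {group gT}) : M \proper G ->
  exists k, exists2 g, g \in G & M \subset std k :^ g.
Proof.
move=> prM; have sMG := proper_sub prM.
have [M1 | ntM] := eqVneq (M : {set gT}) 1.
  by exists Point, 1; rewrite ?group1 // M1 sub1G.
have [few | many] := leqP (size (primes #|M|)) 2.
  have solM := Burnside_p_a_q_b few.
  have [Q minQ sQM] := minnormal_exists ntM (normG M).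
  have [nQM ntQ abQ] := minnormal_solvable minQ sQM solM.
  have sQG := subset_trans sQM sMG; have nGQM: M \subset 'N_G(Q) by rewrite subsetI sMG.
  have pQ := abelem_pgroup abQ; move: abQ pQ; rewrite /is_abelem; set p := pdiv _.
  have: p \in primes 5616.
    rewrite mem_primes -(card_G c) cardG_gt0 pdiv_prime ?cardG_gt1 //=.
    by rewrite (dvdn_trans (pdiv_dvd _)) ?cardSg.
  rewrite primes_5616 !inE => /or3P[] /eqP-> abQ pQ.
  - exact: norm_2group_sub_std abQ ntQ nGQM.
  - exact: norm_3group_sub_std pQ ntQ nGQM.
  by have [g Gg [sM _]] := norm_13group_sub_std sQG pQ ntQ nGQM; exists Singer, g.
have sub: {subset primes #|M| <= [:: 2; 3; 13]}.
  move=> p pM; rewrite -primes_5616; move: pM.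
  rewrite !mem_primes -(card_G c) !cardG_gt0 => /and3P[-> _] /=.
  by move/dvdn_trans; apply; apply: cardSg.
have [_ eqp] := uniq_min_size (primes_uniq _) sub many.
have: G \subset M by apply: three_primes_full => // p; rewrite -eqp.
by case/andP: prM => _ /negP.
Qed.

End Overgroups.

(** * Maximal subgroups and solubilizers *)

(** These are the pairs of distinct kinds for which the order of the first
    subgroup divides the order of the second: no conjugate of the second
    contains the first. *)
Lemma kinds_incomparable : all (fun kl => let l := [seq a <- sl3 | in_std kl.1 a] in
    all (fun g => has (fun a => ~~ in_std kl.2 (mconj g a)) l) sl3)
  [:: (Point, Line); (Line, Point); (Frame, Point); (Frame, Line)].
Proof. by lazy. Qed.

Lemma kinds_not_normal : all (fun k => let l := [seq a <- sl3 | in_std k a] in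
    has (fun g => has (fun a => ~~ in_std k (mconj g a)) l) sl3) kinds.
Proof. by lazy. Qed.

(** A greedy choice, from the elements g of l such that r lies in the
    conjugate by g of the subgroup of kind k, of one element of each coset of
    that subgroup. As the subgroup is its own normalizer, the chosen elements
    stand for distinct conjugates. *)
Definition conj_reps_in k r l := foldr (fun g T =>
  if ~~ in_std k (mconj g r) || has (fun t => in_std k (mmul g (minv t))) T then T
  else g :: T) [::] l.
Definition conj_reps k r := conj_reps_in k r sl3.
Arguments conj_reps : simpl never.

Lemma mem_kinds k : k \in kinds. Proof. by case: k. Qed.

Lemma conj_reps_inP k r l (T := conj_reps_in k r l) : {subset l <= sl3} ->
  [/\ {subset T <= l}, all (fun t => in_std k (mconj t r)) T,
      pairwise (fun g t => ~~ in_std k (mmul g (minv t))) T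
    & {in l, forall g, in_std k (mconj g r) -> has (fun t => in_std k (mmul g (minv t))) T}].
Proof.
rewrite {}/T; elim: l => [|g l IH] sl /=; first by split.
have [|sub inT pw cov] := IH; first by move=> h hl; rewrite sl // inE hl orbT.
set T := conj_reps_in k r l in sub inT pw cov *.
have sub' : {subset T <= g :: l} by move=> h /sub hl; rewrite inE hl orbT.
case: ifPn => [skip | keep].
  split=> // h; rewrite inE => /orP[/eqP-> Ag | /cov//].
  by move: skip; rewrite Ag.
move: keep; rewrite negb_or negbK => /andP[Ag noT]; split=> /=.
- by move=> h; rewrite !inE => /orP[-> // | /sub->]; rewrite orbT.
- by rewrite Ag.
- by rewrite pw andbT all_predC.
move=> h; rewrite inE => /orP[/eqP-> _ | hl Ah]; last by rewrite cov ?orbT.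
rewrite (meqP _ _ (allP mmul_minv g _)); last by rewrite sl ?inE ?eqxx.
by case: (k).
Qed.

Lemma conj_repsP k r (T := conj_reps k r) :
  [/\ {subset T <= sl3}, all (fun t => in_std k (mconj t r)) T,
      pairwise (fun g t => ~~ in_std k (mmul g (minv t))) T
    & {in sl3, forall g, in_std k (mconj g r) -> has (fun t => in_std k (mmul g (minv t))) T}].
Proof. exact: conj_reps_inP. Qed.

Definition covers Ts y := has (fun kT => has (fun t => in_std kT.1 (mconj t y)) kT.2) Ts.
(** The number of conjugates of each kind that contain r, and the number of
    elements of their union. *)
Definition table r := let Ts := [seq (k, conj_reps k r) | k <- kinds] in
  ([seq size kT.2 | kT <- Ts], count (covers Ts) sl3).

Definition rep_table i : seq nat * nat := nth ([::], 0)%N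
  [:: ([:: 5; 5; 0; 18], 2832); ([:: 4; 4; 0; 0], 2376); ([:: 1; 1; 6; 3], 1026);
      ([:: 1; 1; 0; 2], 848); ([:: 2; 2; 0; 0], 1368); ([:: 1; 1; 0; 0], 816);
      ([:: 0; 0; 1; 0], 39)]%N i.

Lemma table_check : all (fun i => table (rep i) == rep_table i) (iota 0 7).
Proof. by vm_compute. Qed.

Section Maximal.

Variables (gT : finGroupType) (G : {group gT}) (c : coordinates G).
Local Notation code := (code c).
Local Notation elt := (elt c).
Local Notation std := (std c).

Lemma mem_std_conj k u g : u \in G -> g \in G ->
  (u \in std k :^ g) = in_std k (mconj (code g) (code u)).
Proof. by move=> Gu Gg; rewrite mem_conjg mem_std ?groupJ ?groupV // code_conj. Qed.

Lemma has_filter_code k (p : pred mat) :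
  has p [seq a <- sl3 | in_std k a] -> exists2 a, a \in std k & p (code a).
Proof.
case/hasP=> m; rewrite mem_filter => /andP[Am m3] pm; have [Gm cm] := eltP c m3.
by exists (elt m); rewrite ?mem_std ?cm.
Qed.

Lemma std_incomparable k l g : g \in G -> std k \subset std l :^ g -> k = l.
Proof.
move=> Gg sA; apply/eqP; apply: contraT => nkl.
have dvdkl: kind_order k %| kind_order l by rewrite -!(card_std c) -(cardJg (std l) g) cardSg.
suffices kl: (k, l) \in [:: (Point, Line); (Line, Point); (Frame, Point); (Frame, Line)].
  have H: all (fun h => has (fun a => ~~ in_std l (mconj h a)) [seq a <- sl3 | in_std k a]) sl3.
    exact: (allP kinds_incomparable (k, l) kl).
  have /has_filter_code[a Aa] := all_sl3 c H Gg; have Ga := subsetP (sub_std c k) a Aa.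
  by rewrite -mem_std_conj // (subsetP sA).
by move: dvdkl nkl; case: k {sA}; case: l; vm_compute.
Qed.

Lemma std_not_normal k : ~~ (G \subset 'N(std k)).
Proof.
have H: has (fun h => has (fun a => ~~ in_std k (mconj h a)) [seq a <- sl3 | in_std k a]) sl3.
  exact: (allP kinds_not_normal k (mem_kinds k)).
have /hasP[m m3 /has_filter_code[a Aa]] := H; have [Gm cm] := eltP c m3.
have Ga := subsetP (sub_std c k) a Aa.
rewrite -cm -mem_std_conj //; apply: contra => /subsetP nAG.
by have /normP-> := nAG _ Gm.
Qed.

Lemma std_proper k : std k \proper G.
Proof.
rewrite properEcard sub_std card_std (card_G c); apply: leq_ltn_trans (_ : 432 < _)%N.
  by case: k.
by vm_compute.
Qed.

(** A conjugate of one of the four subgroups is contained in a conjugate of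
    another one only if both have the same kind, hence the same order. *)
Lemma maximalP (M : {group gT}) :
  reflect (exists k, exists2 g, g \in G & M :=: std k :^ g) (maximal M G).
Proof.
apply: (iffP idP) => [maxM | [k [g Gg ->]]].
  have [k [g Gg sM]] := proper_sub_std c (maxgroupp maxM); exists k, g => //.
  have [_ maxM'] := maxgroupP maxM; apply/esym/(maxM' (std k :^ g)%G) => //.
  by rewrite -(conjGid Gg) properJ std_proper.
apply/maxgroupP; split=> [|H prH sAH].
  by rewrite -(conjGid Gg) properJ std_proper.
have [l [h Gh sH]] := proper_sub_std c prH.
have sAA := subset_trans sAH sH; have Ekl: k = l.
  by apply: (@std_incomparable _ _ (h * g^-1)); rewrite ?groupM ?groupV // conjsgM -sub_conjg.
by apply/eqP; rewrite eq_sym eqEcard sAH cardJg {1}Ekl -(cardJg (std l) h) subset_leq_card.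
Qed.

Lemma norm_std k : 'N_G(std k) = std k.
Proof.
have /maxgroupP[_ maxA]: maximal (std k) G by apply/maximalP; exists k, 1; rewrite ?conjsg1.
apply: (maxA 'N_G(std k)%G); last by rewrite subsetI sub_std normG.
by rewrite properE subsetIl subsetI subxx /= std_not_normal.
Qed.

Lemma solvable_maximal (M : {group gT}) : maximal M G -> solvable M.
Proof.
case/maximalP=> k [g _ ->]; apply: Burnside_p_a_q_b; rewrite cardJg card_std.
by case: k; vm_compute.
Qed.

(** The group <x, y> is proper when it is soluble, since G is not soluble,
    and then it lies in a maximal subgroup. Conversely maximal subgroups are
    soluble, because at most two primes divide their orders. *)
Lemma Sol_maximals x : x \in G -> Sol G x = \bigcup_(M in maximals_at G x) M.
Proof.
move=> Gx; apply/setP=> y; rewrite inE; apply/andP/bigcupP.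
  case=> Gy solxy; have prxy: <<[set x; y]>> \proper G.
    rewrite properEneq gen_subG subUset !sub1set Gx Gy /= andbT.
    by apply: contraTneq solxy => ->; apply: not_solvable.
  have [k [g Gg]] := proper_sub_std c prxy; rewrite gen_subG subUset !sub1set => /andP[Ax Ay].
  exists (std k :^ g)%G => //; rewrite inE Ax andbT.
  by apply/maximalP; exists k, g.
case=> M; rewrite inE => /andP[maxM Mx] My; have /proper_sub/subsetP sMG := maxgroupp maxM.
split; first exact: sMG.
by apply: solvableS (solvable_maximal maxM); rewrite gen_subG subUset !sub1set Mx.
Qed.

Definition at_kind k x := [set M : {group gT} | (gval M \in std k :^: G) & x \in M].

Lemma maximals_at_kinds x (M : {group gT}) :
  (M \in maximals_at G x) = has (fun k => M \in at_kind k x) kinds.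
Proof.
rewrite inE; apply/andP/hasP => [[/maximalP[k [g Gg EM]] Mx] | [k _]].
  by exists k; rewrite ?mem_kinds // inE Mx andbT EM imset_f.
rewrite inE => /andP[/imsetP[g Gg EM] Mx]; split=> //.
by apply/maximalP; exists k, g.
Qed.

Lemma at_kind_inj k l x (M : {group gT}) : M \in at_kind k x -> M \in at_kind l x -> k = l.
Proof.
rewrite !inE => /andP[/imsetP[g Gg Eg] _] /andP[/imsetP[h Gh Eh] _].
apply: (@std_incomparable _ _ (h * g^-1)); rewrite ?groupM ?groupV // conjsgM -sub_conjg.
by rewrite -Eg Eh.
Qed.

Lemma at_kindE k x : x \in G ->
  at_kind k x = [set:: [seq (std k :^ elt t)%G | t <- conj_reps k (code x)]].
Proof.
move=> Gx; have [sub /allP inT _ cov] := conj_repsP k (code x).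
apply/setP=> M; rewrite !inE; apply/andP/mapP => [[/imsetP[g Gg EM] Mx] | [t Tt ->]].
  have Axg: in_std k (mconj (code g) (code x)) by rewrite -mem_std_conj // -EM.
  have /hasP[t Tt At] := cov _ (code_sl3 _ Gg) Axg.
  exists t => //; apply: val_inj; rewrite /= EM; have [Gt ct] := eltP c (sub t Tt).
  have: g * (elt t)^-1 \in std k by rewrite mem_std ?groupM ?groupV // codeM ?groupV // codeV // ct.
  by move=> Agt; rewrite -{1}(mulgKV (elt t) g) conjsgM conjGid.
have [Gt ct] := eltP c (sub t Tt); split; first by apply/imsetP; exists (elt t).
by rewrite /= mem_std_conj // ct inT.
Qed.

(** Two elements that carry the subgroup to the same conjugate differ by an
    element of its normalizer, which is the subgroup itself. *)
Lemma card_at_kind k x : x \in G -> #|at_kind k x| = size (conj_reps k (code x)).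
Proof.
move=> Gx; rewrite at_kindE // cardsE.
have [sub _ pw _] := conj_repsP k (code x).
rewrite -(size_map (fun t => (std k :^ elt t)%G)); apply/card_uniqP.
rewrite uniq_pairwise pairwise_map.
suffices H: {in sl3 &, subrel (fun g t => ~~ in_std k (mmul g (minv t)))
    (fun g t => (std k :^ elt g)%G != (std k :^ elt t)%G)}.
  exact: (sub_in_pairwise H (introT allP sub) pw).
move=> g t g3 t3; have [Gg cg] := eltP c g3; have [Gt ct] := eltP c t3.
apply: contra => /eqP/(congr1 val)/= E.
have: elt g * (elt t)^-1 \in std k.
  rewrite -norm_std; apply/setIP; split; first by rewrite groupM ?groupV.
  by apply/normP; rewrite conjsgM E conjsgK.
by rewrite mem_std ?groupM ?groupV // codeM ?groupV // codeV // cg ct.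
Qed.

Lemma card_Sol x : x \in G -> #|Sol G x| = (table (code x)).2.
Proof.
move=> Gx; rewrite Sol_maximals //.
rewrite -[RHS]/(count (covers [seq (k, conj_reps k (code x)) | k <- kinds]) sl3).
rewrite -(card_sl3 c); apply: eq_card => y; rewrite [in RHS]inE.
apply/bigcupP/andP => [[M] | [Gy]].
  rewrite maximals_at_kinds => /hasP[k kk]; rewrite at_kindE // inE => /mapP[t Tt ->] Ay.
  have [sub _ _ _] := conj_repsP k (code x).
  have [Gt ct] := eltP c (sub t Tt).
  have Gy: y \in G by move: Ay; apply/subsetP; rewrite conj_subG ?sub_std.
  split=> //; apply/hasP; exists (k, conj_reps k (code x)); first exact: map_f.
  by apply/hasP; exists t; rewrite // -ct -mem_std_conj.
case/hasP=> _ /mapP[k kk ->] /= /hasP[t Tt Aty].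
have [sub _ _ _] := conj_repsP k (code x).
have [Gt ct] := eltP c (sub t Tt).
exists (std k :^ elt t)%G; last by rewrite /= mem_std_conj // ct.
rewrite maximals_at_kinds; apply/hasP; exists k => //.
by rewrite at_kindE // inE; apply/mapP; exists t.
Qed.

End Maximal.

(** * Isomorphism types *)

Lemma card_AGL2 : #|AGL 2 F3| = 432.
Proof.
rewrite -(sdprod_card (sdprod_sdpair ('MR (GLrepr F3 1))%gact)).
rewrite !card_injm ?injm_sdpair1 ?injm_sdpair2 // cardsT card_mx.
by rewrite (card_GL_2 F3) card_Fp; vm_compute.
Qed.

Lemma det_block1 (a : 'M[F3]_2) (v : 'rV[F3]_2) :
  (\det (block_mx a 0 v 1%:M : 'M_(2 + 1)) = \det a)%R.
Proof. by rewrite det_lblock det1 GRing.mulr1. Qed.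

Section Affine.

Variables (gT : finGroupType) (G : {group gT}) (c : coordinates G).
Local Notation code := (code c).
Local Notation elt := (elt c).
Local Notation std := (std c).
Local Notation rG := (natural_repr c).

(** The matrix that maps (w, 1) to (w a + v, 1), where (a, v) stands for the
    affine map sending w to w a + v. *)
Definition affine_mx (u : AGL_type 2 F3) : 'M[F3]_(2 + 1) :=
  (block_mx (GLval u.1) 0 (u.2 : 'rV_2) 1%:M)%R.

Lemma affine_mx_unit u : affine_mx u \in unitmx.
Proof. by rewrite unitmxE det_block1 -unitmxE; apply: (valP u.1). Qed.

Lemma affine_mxM u v : affine_mx (u * v) = (affine_mx u *m affine_mx v)%R.
Proof.
rewrite /affine_mx mulmx_block !mulmx0 !mul0mx !GRing.addr0 !GRing.add0r !mul1mx.
have -> : (u * v).1 = u.1 * v.1 by [].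
have -> : (u * v).2 = (mx_repr_act (GLrepr F3 1) u.2 v.1 + v.2)%R by [].
by rewrite mx_repr_actE ?inE // GL_MxE.
Qed.

Definition affine_lift (u : AGL_type 2 F3) := proj_lift c (affine_mx u).

Lemma affine_liftM : {in [set: AGL_type 2 F3] &, {morph affine_lift : u v / u * v}}.
Proof. by move=> u v _ _; rewrite /affine_lift affine_mxM proj_liftM ?affine_mx_unit. Qed.
Canonical affine_lift_morphism := Morphism affine_liftM.

Lemma injm_affine_lift : 'injm affine_lift.
Proof.
apply/injmP=> u v _ _ /(proj_lift_inj (affine_mx_unit _) (affine_mx_unit _)).
have sc (d : F3) w : (d *: affine_mx w)%R =
    block_mx (d *: GLval w.1)%R (d *: 0)%R (d *: (w.2 : 'rV_2))%R (d *: 1%:M)%R.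
  exact: (@scale_block_mx _ 2 1 2 1).
rewrite !sc /affine_mx !det_block1 => /(@eq_block_mx _ 2 1 2 1)[Ea _ Ev Ed].
(* the corner entry of the lift of (a, v) is the determinant of a *)
have{Ed} Ed: (\det (GLval u.1) = \det (GLval v.1))%R.
  by move/matrixP/(_ ord0 ord0): Ed; rewrite !mxE !GRing.mulr1.
have d0: (\det (GLval u.1) != 0)%R by rewrite -GRing.unitfE -unitmxE; apply: (valP u.1).
move: Ea Ev; rewrite -Ed => /(GRing.scalerI d0) Ea /(GRing.scalerI d0) Ev.
by apply: val_inj; apply: injective_projections => //; apply: val_inj.
Qed.

Lemma affine_lift_sub : affine_lift @* [set: AGL_type 2 F3] \subset std Line.
Proof.
apply/subsetP=> _ /morphimP[u _ _ ->].
have [Gu Eu] := proj_liftP c (affine_mx_unit u).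
apply: (@triangular_repr _ _ c 2) => // i j /andP[lti lej].
rewrite Eu mxE [X in (_ * X)%R](_ : _ = 0%R) ?GRing.mulr0 //.
have -> : i = lshift 1 (Ordinal lti) by apply: val_inj.
have -> : j = rshift 2 (ord0 : 'I_1).
  by apply/val_inj/eqP; rewrite eqn_leq -ltnS ltn_ord.
by rewrite [LHS](@block_mxEur _ 2 1 2 1) mxE.
Qed.

Lemma isog_Line : std Line \isog AGL 2 F3.
Proof.
rewrite isog_sym; apply/isogP; exists affine_lift_morphism; first exact: injm_affine_lift.
apply/eqP; rewrite eqEcard affine_lift_sub card_injm ?injm_affine_lift //.
by rewrite card_std (card_AGL2 : #|[set: AGL_type 2 F3]| = 432).
Qed.

Definition antidiag := M3 (V3 Z0 Z0 N1) (V3 Z0 N1 Z0) (V3 N1 Z0 Z0).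
(** The inverse transpose of the stabilizer of a plane is the stabilizer of
    the line orthogonal to it. The line orthogonal to the plane of the first
    two coordinates is the third axis, which the antidiagonal matrix moves to
    the first. *)
Definition dual u := elt (mtr (code u^-1)) ^ (elt antidiag)^-1.

Lemma mtr_sl3 m : m \in sl3 -> mtr m \in sl3.
Proof.
rewrite !mem_sl3 -!(can_eq FofK) -!det_mx_of -(det_tr (mx_of m)) => /eqP <-.
apply/eqP; congr (\det _)%R; apply/matrixP=> i j; rewrite !mxE.
by case: m => [[? ? ?] [? ? ?] [? ? ?]]; elim/ord3P: i; elim/ord3P: j.
Qed.

Lemma mtr_mmul m n : mtr (mmul m n) = mmul (mtr n) (mtr m).
Proof.
have mx_tr k : mx_of (mtr k) = (mx_of k)^T%R.
  apply/matrixP=> i j; rewrite !mxE.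
  by case: k => [[? ? ?] [? ? ?] [? ? ?]]; elim/ord3P: i; elim/ord3P: j.
by apply: (can_inj mx_ofK); rewrite mx_ofM !mx_tr mx_ofM trmx_mul.
Qed.

Lemma dualM : {in G &, {morph dual : u v / u * v}}.
Proof.
move=> u v Gu Gv; rewrite /dual -conjMg; congr (_ ^ _).
have tr3 w : w \in G -> mtr (code w^-1) \in sl3.
  by move=> Gw; apply/mtr_sl3/code_sl3; rewrite groupV.
have [Gtu cu] := eltP c (tr3 u Gu); have [Gtv cv] := eltP c (tr3 v Gv).
have [Guv cuv] := eltP c (tr3 _ (groupM Gu Gv)).
apply: (code_inj (c := c)); rewrite ?groupM // cuv codeM // cu cv -mtr_mmul.
by rewrite -codeM ?groupV // invMg.
Qed.
Canonical dual_morphism := Morphism dualM.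

Lemma mtrK : involutive mtr. Proof. by case=> [[? ? ?] [? ? ?] [? ? ?]]. Qed.

Lemma injm_dual : 'injm dual.
Proof.
apply/injmP=> u v Gu Gv /conjg_inj/(congr1 code).
rewrite !eltK ?mtr_sl3 ?code_sl3 ?groupV // => /(can_inj mtrK)/code_inj.
by rewrite !groupV => /(_ Gu Gv)/invg_inj.
Qed.

Lemma transpose_Line : all (fun m =>
  in_std Line m ==> in_std Point (mconj antidiag (mtr m))) sl3.
Proof. by vm_compute. Qed.

Lemma isog_Point : std Point \isog AGL 2 F3.
Proof.
apply: isog_trans isog_Line; rewrite isog_sym.
apply: (isog_trans (sub_isog (sub_std c Line) injm_dual)).
suffices <-: dual @* std Line = std Point by apply: isog_refl.
apply/eqP; rewrite eqEcard card_injm ?injm_dual ?sub_std // !card_std leqnn andbT.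
apply/subsetP=> _ /morphimP[u Gu Au ->].
have [Gt ct] := eltP c (mtr_sl3 (code_sl3 (c := c) _ (groupVr Gu))).
have [Gd cd] := eltP c (isT : antidiag \in sl3).
rewrite mem_std ?groupJ ?groupV // code_conj // ct cd.
apply: (implyP (all_sl3 c transpose_Line (groupVr Gu))).
by rewrite -mem_std ?groupV.
Qed.

End Affine.

(** The cube of the cubing map raises to the power 27 = 2 * 13 + 1, so it is
    the identity. *)
Lemma cubing_Aut (gT : finGroupType) (b : gT) : #[b] = 13 ->
  exists s, [/\ s \in Aut <[b]>, #[s] %| 3 & s b = b ^+ 3].
Proof.
move=> ob; have inj3: 'injm (cyclem 3 b).
  apply/subsetP=> x /setIdP[bx]; rewrite !inE -order_dvdn => ox3.
  have ox13: (#[x] %| 13)%N by rewrite -ob order_dvdG.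
  by rewrite -order_eq1 -dvdn1 -(eqP (isT : gcdn 3 13 == 1)%N) dvdn_gcd ox3.
have im3: cyclem 3 b @* <[b]> = <[b]>.
  apply/eqP; rewrite eqEcard card_injm // leqnn andbT.
  by rewrite morphim_cycle ?cycle_id // cycle_subG /= /cyclem mem_cycle.
have sE x : x \in <[b]> -> aut inj3 im3 x = x ^+ 3 by move=> bx; rewrite autE.
have [A3 bb] := (Aut_aut inj3 im3, cycle_id b).
exists (aut inj3 im3); split; rewrite ?sE //.
rewrite order_dvdn; apply/eqP/(eq_Aut (groupX 3 A3) (group1 _)) => x bx.
rewrite perm1 !expgS expg0 mulg1 !permM !sE ?groupX //.
rewrite -!expgM (_ : 3 * (3 * 3) = #[b] * 2 + 1)%N ?ob // expgD expgM.
by rewrite (_ : x ^+ 13 = 1) ?expg1n ?mul1g //; apply/eqP; rewrite -order_dvdn -ob order_dvdG.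
Qed.

Lemma C13_C3_Grp : C13_C3 \isog Grp (x : y : x ^+ 13, y ^+ 3, x ^ y = x ^+ 3).
Proof. by apply: Extremal.Grp => //; apply: cubing_Aut; rewrite order_Zp1. Qed.

Lemma card_C13_C3 : #|C13_C3| = 39.
Proof. exact: Extremal.card. Qed.

Section Singer.

Variables (gT : finGroupType) (G : {group gT}) (c : coordinates G).
Local Notation s := (elt c singer).

Lemma isog_Singer : std c Singer \isog C13_C3.
Proof.
have [Gs cs os on] := singerP c.
have /hasP[m m3 /andP[/meqP m_cube /meqP m_3]] := singer_cube.
have [Gm cm] := eltP c m3.
set y := (elt c m)^-1.
have sy: s ^ y = s ^+ 3.
  by apply: (code_inj (c := c)); rewrite ?groupJ ?groupX ?groupV // code_conj // codeX // cm cs.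
have y3: y ^+ 3 = 1.
  apply/eqP; rewrite expgVn invg_eq1; apply/eqP/(code_inj (c := c)); rewrite ?groupX //.
  by rewrite codeX // cm m_3 code1.
have nsy: <[y]> \subset 'N(<[s]>) by rewrite norms_cycle sy mem_cycle.
have defA: <[s]> <*> <[y]> = std c Singer.
  have sub: <[s]> <*> <[y]> \subset 'N_G(<[s]>).
    by rewrite join_subG !subsetI nsy normG !cycle_subG Gs groupV Gm.
  rewrite -[RHS]/(std_set c Singer) std_set_Singer.
  apply/eqP; rewrite eqEcard sub on; apply: dvdn_leq => //.
  (* the join has elements of orders 13 and 3, so its order is at least 39 *)
  rewrite -[39]/(13 * 3)%N Gauss_dvd // -{1}os cardSg ?joing_subl //=.
  suffices <-: #[y] = 3 by rewrite cardSg ?joing_subr.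
  apply: nt_prime_order => //; apply/eqP=> y1; move: sy; rewrite y1 conjg1.
  by move/eqP; rewrite -{1}[s]expg1 eq_expg_mod_order os.
apply/(isoGrpP _ C13_C3_Grp); rewrite card_std card_C13_C3; split=> //.
apply/existsP; exists (s, y); rewrite /= !xpair_eqE -defA eqxx /=.
by rewrite -{1}os expg_order y3 sy !eqxx.
Qed.
End Singer.

Section Hadamard.

(** Three rows of a Hadamard matrix of order 4, without the constant one.
    As 4 = 1 in the field, they form an orthonormal basis of the space of
    vectors of sum zero. *)
Definition hadamard : 'M[F3]_(3, 4) :=
  \matrix_(i, j) (if (j == 0 :> nat) || (j == i.+1 :> nat) then 1 else -1)%R.
Local Notation H := hadamard.

Lemma big_ord4 (V : zmodType) (F : 'I_4 -> V) : (\sum_(i < 4) F i =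
  F (@Ordinal 4 0 isT) + F (@Ordinal 4 1 isT) + F (@Ordinal 4 2 isT) + F (@Ordinal 4 3 isT))%R.
Proof.
rewrite !big_ord_recl big_ord0 GRing.addr0 !GRing.addrA.
by congr (F _ + F _ + F _ + F _)%R; apply: val_inj.
Qed.

Lemma ord4P (P : 'I_4 -> Prop) : P (@Ordinal 4 0 isT) -> P (@Ordinal 4 1 isT) ->
  P (@Ordinal 4 2 isT) -> P (@Ordinal 4 3 isT) -> forall i, P i.
Proof.
move=> P0 P1 P2 P3 [[|[|[|[|i]]]] lti] //;
  [have := P0 | have := P1 | have := P2 | have := P3]; congr P; exact/val_inj.
Qed.

Lemma hadamard_mulT : (H *m H^T = 1%:M)%R.
Proof.
apply/matrixP=> i j; rewrite !mxE big_ord4 !mxE.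
by elim/ord3P: i; elim/ord3P: j; apply/eqP.
Qed.

(** The orthogonal projection onto the vectors of sum zero. *)
Lemma hadamard_Tmul : (H^T *m H = 1%:M - const_mx 1)%R.
Proof.
apply/matrixP=> i j; rewrite !mxE big_ord3 !mxE.
by elim/ord4P: i; elim/ord4P: j; apply/eqP.
Qed.

Lemma hadamard_const : (H *m const_mx 1 = 0 :> 'M[F3]_(3, 4))%R.
Proof.
apply/matrixP=> i j; rewrite !mxE big_ord4 !mxE.
by elim/ord3P: i; apply/eqP.
Qed.

(** The action of a permutation of the four coordinates on the vectors of sum
    zero, in the basis of the rows of H. *)
Definition tetra_mx (s : 'S_4) : 'M[F3]_3 := (H *m perm_mx s *m H^T)%R.

Lemma perm_mx_const (s : 'S_4) : (perm_mx s *m const_mx 1 = const_mx 1 :> 'M[F3]_4)%R.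
Proof. by rewrite -row_permE; apply/matrixP=> i j; rewrite !mxE. Qed.

Lemma tetra_mx1 : tetra_mx 1 = 1%:M%R.
Proof. by rewrite /tetra_mx perm_mx1 mulmx1 hadamard_mulT. Qed.

Lemma tetra_mxM s t : tetra_mx (s * t) = (tetra_mx s *m tetra_mx t)%R.
Proof.
rewrite /tetra_mx perm_mxM !mulmxA -[(_ *m H^T *m H)%R]mulmxA hadamard_Tmul.
rewrite mulmxBr mulmx1 -[(_ *m const_mx 1)%R]mulmxA perm_mx_const hadamard_const.
by rewrite GRing.subr0.
Qed.

Lemma tetra_mx_unit s : tetra_mx s \in unitmx.
Proof.
have E: (tetra_mx s *m tetra_mx s^-1 = 1%:M)%R by rewrite -tetra_mxM mulgV tetra_mx1.
exact: (mulmx1_unit E).1.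
Qed.

Lemma tetra_mxE s i j : (tetra_mx s i j = \sum_k H i k * H j (s k))%R.
Proof.
rewrite /tetra_mx -mulmxA -row_permE !mxE; apply: eq_bigr => k _.
by rewrite !mxE.
Qed.

Lemma const_mul_perm_mx (s : 'S_4) : (const_mx 1 *m perm_mx s = const_mx 1 :> 'M[F3]_4)%R.
Proof. by rewrite -[s]invgK -col_permE; apply/matrixP=> i j; rewrite !mxE. Qed.

Lemma hadamard_tetra_mx s : (H^T *m tetra_mx s *m H = perm_mx s - const_mx 1)%R.
Proof.
rewrite /tetra_mx !mulmxA hadamard_Tmul -[(_ *m H^T *m H)%R]mulmxA hadamard_Tmul.
rewrite mulmxBl mul1mx const_mul_perm_mx mulmxBr mulmx1 mulmxBl perm_mx_const.
suffices ->: ((const_mx 1 : 'M[F3]_4) *m (const_mx 1 : 'M_4) = const_mx 1)%R.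
  by rewrite GRing.subrr GRing.subr0.
by apply/matrixP=> i j; rewrite !mxE big_ord4 !mxE; apply/eqP.
Qed.

(** If s acts as the scalar e then perm_mx s - J = e (1 - J), where J is the
    matrix of ones. At the entry (i, s i) the left side vanishes, whereas the
    right side is -e when s i differs from i. *)
Lemma tetra_mx_scalar s (e : F3) : (e != 0)%R -> tetra_mx s = e%:M%R -> s = 1.
Proof.
move=> e0 Es; apply/permP=> i; rewrite perm1; apply/eqP; apply: contraTT isT => nsi.
have /matrixP/(_ i (s i)) := hadamard_tetra_mx s.
rewrite Es mul_mx_scalar -scalemxAl hadamard_Tmul !mxE eqxx GRing.subrr eq_sym (negbTE nsi).
by rewrite GRing.sub0r GRing.mulrN1 => /eqP; rewrite GRing.oppr_eq0 (negbTE e0).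
Qed.

(** The action of the transposition of 0 and k: for k > 0 it fixes one
    coordinate axis and exchanges the two others up to sign. *)
Definition tetra_swap (k : nat) : mat := nth mone
  [:: mone; M3 (V3 P1 Z0 Z0) (V3 Z0 Z0 N1) (V3 Z0 N1 Z0);
     M3 (V3 Z0 Z0 N1) (V3 Z0 P1 Z0) (V3 N1 Z0 Z0); M3 (V3 Z0 N1 Z0) (V3 N1 Z0 Z0) (V3 Z0 Z0 P1)] k.

Lemma tetra_tperm (y : 'I_4) : tetra_mx (tperm ord0 y) = mx_of (tetra_swap y).
Proof.
apply/matrixP=> i j; rewrite tetra_mxE big_ord4 !mxE /tperm !permE /=.
by elim/ord4P: y; elim/ord3P: i; elim/ord3P: j; apply/eqP.
Qed.

Lemma monom_scale (d : F3) m : monom m -> monom (code_mx (d *: mx_of m)%R).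
Proof.
rewrite -[d]ofFK; set t := ofF d.
have ->: code_mx (Fof t *: mx_of m)%R =
    let: M3 p q r := m in M3 (vscale t p) (vscale t q) (vscale t r).
  apply: (can_inj mx_ofK); rewrite code_mxK; apply/matrixP=> i j; rewrite !mxE.
  by case: m => p q r; elim/ord3P: i; rewrite /= Fof_vscale.
have sc v : unitv v -> unitv (vscale t v) by case: v; do 3!case=> //; case: (t).
by case: m => p q r /and3P[/sc p1 /sc q1 /sc r1]; apply/and3P.
Qed.

End Hadamard.

Section Tetrahedral.

Variables (gT : finGroupType) (G : {group gT}) (c : coordinates G).
Local Notation rG := (natural_repr c).

Definition tetra_lift s := proj_lift c (tetra_mx s).

Lemma tetra_liftM : {in [set: 'S_4] &, {morph tetra_lift : s t / s * t}}.
Proof. by move=> s t _ _; rewrite /tetra_lift tetra_mxM proj_liftM ?tetra_mx_unit. Qed.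
Canonical tetra_lift_morphism := Morphism tetra_liftM.

Lemma injm_tetra_lift : 'injm tetra_lift.
Proof.
apply/subsetP=> s /mker E; have [_ Es] := proj_liftP c (tetra_mx_unit s).
set d := (\det (tetra_mx s))%R in Es.
have d0: (d != 0)%R by rewrite -GRing.unitfE -unitmxE tetra_mx_unit.
rewrite inE; apply/eqP/(@tetra_mx_scalar s d^-1%R); first by rewrite GRing.invr_eq0.
rewrite -scalemx1 -(repr_mx1 rG) -E [rG _]Es GRing.scalerA GRing.mulVf //.
by rewrite GRing.scale1r.
Qed.

(** The transpositions that move 0 generate S_4 and act by monomial matrices. *)
Lemma tetra_lift_sub : tetra_lift @* [set: 'S_4] \subset std c Frame.
Proof.
have sub: [set tperm (ord0 : 'I_4) y | y : 'I_4] \subset tetra_lift @*^-1 (std c Frame).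
  apply/subsetP=> _ /imsetP[y _ ->]; apply/morphpreP; split; first exact: in_setT.
  have [Gy Ey] := proj_liftP c (tetra_mx_unit (tperm ord0 y)).
  rewrite mem_std // -[code c _]mx_ofK -[mx_of _]/(rG _) Ey tetra_tperm.
  by apply: monom_scale; elim/ord4P: y {Gy Ey}.
have gen: [set: 'S_4] \subset <<[set tperm (ord0 : 'I_4) y | y : 'I_4]>>.
  by rewrite gen_tperm.
by rewrite sub_morphim_pre // (subset_trans gen) // gen_subG.
Qed.

Lemma isog_Frame : std c Frame \isog [set: 'S_4].
Proof.
rewrite isog_sym; apply/isogP; exists tetra_lift_morphism; first exact: injm_tetra_lift.
apply/eqP; rewrite eqEcard tetra_lift_sub card_injm ?injm_tetra_lift //.
by rewrite card_std cardsT card_Sn.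
Qed.

End Tetrahedral.

(** * Values for every element *)

(** Point and line stabilizers are isomorphic, so they are counted together. *)
Definition rep_hfs i := let sizes := (rep_table i).1 in
  (nth 0 sizes 0 + nth 0 sizes 1, nth 0 sizes 2, nth 0 sizes 3)%N.

Section Invariants.

Variables (gT : finGroupType) (G : {group gT}) (c : coordinates G).
Local Notation code := (code c).
Local Notation elt := (elt c).
Local Notation std := (std c).

Lemma card_at_kinds ks x : uniq ks ->
  #|[set M | has (fun k => M \in at_kind c k x) ks]| = \sum_(k <- ks) #|at_kind c k x|.
Proof.
elim: ks => [_|k ks IH] /=.
  by rewrite big_nil; apply: eq_card0 => M; rewrite inE.
case/andP=> nk /IH{IH} IH; rewrite big_cons -IH.
set R := [set M | has (fun l => M \in at_kind c l x) ks].
rewrite -(_ : at_kind c k x :|: R = [set M | has (fun l => M \in at_kind c l x) (k :: ks)]).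
  rewrite cardsU disjoint_setI0 ?cards0 ?subn0 // -setI_eq0.
  apply/eqP/setP=> M; rewrite !in_set0; apply/negP=> /setIP[Mk]; rewrite inE => /hasP[l lks Ml].
  by move: nk; rewrite (at_kind_inj Mk Ml) lks.
by apply/setP=> M; rewrite in_setU [M \in R]in_set [RHS]in_set.
Qed.

(** Each maximal subgroup has one kind, which determines whether it is
    isomorphic to K. *)
Lemma num_maximals (rT : finGroupType) (K : {group rT}) ks x : uniq ks ->
  (forall k, (std k \isog K) = (k \in ks)) ->
  num_maximals_at G x K = \sum_(k <- ks) #|at_kind c k x|.
Proof.
move=> uks isoA; rewrite -card_at_kinds //; apply: eq_card => M.
have isoM k : M \in at_kind c k x -> (M \isog K) = (k \in ks).
  rewrite inE => /andP[/imsetP[g Gg EM] _].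
  by rewrite -isoA EM; apply: isog_transl; rewrite isog_sym conj_isog.
rewrite [LHS]inE [RHS]inE (maximals_at_kinds c).
apply/andP/hasP => [[/hasP[k _ Mk]] | [k kks Mk]].
  by rewrite (isoM k) //; exists k.
by rewrite (isoM k) // kks; split=> //; apply/hasP; exists k; rewrite ?mem_kinds.
Qed.

Lemma hfs_sizes x : x \in G -> hfs G x =
  (size (conj_reps Point (code x)) + size (conj_reps Line (code x)),
   size (conj_reps Singer (code x)), size (conj_reps Frame (code x)))%N.
Proof.
move=> Gx; have no (rT : finGroupType) (K : {group rT}) k :
    kind_order k != #|K| -> (std k \isog K) = false.
  by apply: contraNF => /card_isog <-; rewrite card_std.
rewrite /hfs (@num_maximals _ _ [:: Point; Line]) //; last first.
  by case; rewrite ?isog_Point ?isog_Line // no // card_AGL2.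
rewrite (@num_maximals _ _ [:: Singer]) //; last first.
  by case; rewrite ?isog_Singer // no // card_C13_C3.
rewrite (@num_maximals _ _ [:: Frame]) //; last first.
  by case; rewrite ?isog_Frame // no //= cardsT card_Sn.
by rewrite !big_cons !big_nil !addn0 !card_at_kind.
Qed.

Lemma rep_values i : (i < 7)%N -> let r := elt (rep i) in
  hfs G r = rep_hfs i /\ #|Sol G r| = (rep_table i).2.
Proof.
move=> lti r; have [Gr cr _ _] := repP c lti.
have i7: i \in iota 0 7 by rewrite mem_iota.
have E := eqP (allP table_check i i7).
by rewrite hfs_sizes // (card_Sol c) // cr E /rep_hfs -E.
Qed.

(** A maximal subgroup contains x exactly when it contains <x>, so only the
    conjugacy class of <x> matters. *)
Lemma conj_maximals_at x r g (M : {group gT}) : g \in G -> <[x]> = <[r]> :^ g ->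
  ((M :^ g)%G \in maximals_at G x) = (M \in maximals_at G r).
Proof.
move=> Gg Ex; rewrite !inE -cycle_subG Ex conjSg cycle_subG; congr (_ && _).
apply/(maximalP c)/(maximalP c) => [[k [h Gh EM]] | [k [h Gh EM]]].
  by exists k, (h * g^-1); rewrite ?groupM ?groupV // conjsgM -EM conjsgK.
by exists k, (h * g); rewrite ?groupM // conjsgM /= EM.
Qed.

Lemma conj_num_maximals (rT : finGroupType) (K : {group rT}) x r g :
  g \in G -> <[x]> = <[r]> :^ g -> num_maximals_at G x K = num_maximals_at G r K.
Proof.
move=> Gg Ex; have injg: injective (fun M : {group gT} => (M :^ g)%G).
  by move=> M N /(congr1 val)/(congr1 (fun X => X :^ g^-1)) /=; rewrite !conjsgK => /val_inj.
have key N : ((N :^ g)%G \in [set M in maximals_at G x | M \isog K]) =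
    (N \in [set M in maximals_at G r | M \isog K]).
  rewrite [LHS]inE [RHS]inE (conj_maximals_at _ Gg Ex); congr (_ && _).
  by apply: isog_transl; rewrite isog_sym conj_isog.
rewrite /num_maximals_at -[RHS](card_imset _ injg); apply: eq_card => M.
apply/idP/imsetP => [MK | [N NK ->]]; last by rewrite key.
have EM: M = ((M :^ g^-1) :^ g)%G by apply: val_inj; rewrite /= conjsgKV.
by exists (M :^ g^-1)%G; rewrite // -key -EM.
Qed.

Lemma conj_Sol x r g : x \in G -> r \in G -> g \in G -> <[x]> = <[r]> :^ g ->
  Sol G x = Sol G r :^ g.
Proof.
move=> Gx Gr Gg Ex; rewrite !(Sol_maximals c) //; apply/setP=> y; rewrite mem_conjg.
apply/bigcupP/bigcupP=> [[M maxM My] | [N maxN Ny]].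
  have EM: M = ((M :^ g^-1) :^ g)%G by apply: val_inj; rewrite /= conjsgKV.
  exists (M :^ g^-1)%G; last by rewrite /= memJ_conjg.
  by rewrite -(conj_maximals_at _ Gg Ex) -EM.
by exists (N :^ g)%G; rewrite ?(conj_maximals_at _ Gg Ex) //= mem_conjg.
Qed.

Lemma element_values x : x \in G -> x != 1 -> exists2 i, (i < 7)%N &
  [/\ #[x] = rep_order i, hfs G x = rep_hfs i, #|Sol G x| = (rep_table i).2
    & #|'N_G(<[x]>)| = rep_norm i].
Proof.
move=> Gx ntx; have [i lti /imsetP[g Gg Ex]] := cycle_conj_rep c Gx ntx.
have [Gr _ or nr] := repP c lti; have [hr sr] := rep_values lti.
exists i => //; split; first by rewrite -or !orderE Ex cardJg.
- by rewrite /hfs !(conj_num_maximals _ Gg Ex) -hr.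
- by rewrite (conj_Sol Gx Gr Gg Ex) cardJg.
by rewrite Ex card_norm_conj.
Qed.

(** A central element generates a normal subgroup, whereas none of the seven
    normalizers is G. *)
Lemma center_trivial : 'Z(G) = 1.
Proof.
apply/trivgP/subsetP=> z Zz; rewrite inE; apply: contraTT isT => ntz.
have Gz := subsetP (center_sub G) z Zz.
have [i lti [_ _ _]] := element_values Gz ntz.
have /setIidPl->: G \subset 'N(<[z]>).
  by rewrite cents_norm // centsC cycle_subG; case/centerP: Zz => _ cz; apply/centP.
move=> Gi; have i7: i \in iota 0 7 by rewrite mem_iota.
have small: all (fun j => rep_norm j != 5616) (iota 0 7) by vm_compute.
by have := allP small i i7; rewrite -Gi (card_G c) eqxx.
Qed.

Lemma maximal_isog (M : {group gT}) : maximal M G ->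
  [\/ M \isog AGL 2 F3, M \isog C13_C3 | M \isog [set: 'S_4]].
Proof.
case/(maximalP c)=> k [g _ EM].
have isoM: M \isog std k by rewrite EM isog_sym conj_isog.
case: k {EM} isoM => isoM; [constructor 1 | constructor 1 | constructor 2 | constructor 3];
  apply: isog_trans isoM _;
  [exact: isog_Point | exact: isog_Line | exact: isog_Singer | exact: isog_Frame].
Qed.

End Invariants.

(** * Coordinates on PSL(3,3) *)

Lemma coordinates_morphim (aT rT : finGroupType) (D G : {group aT}) (f : {morphism D >-> rT}) :
  'injm f -> G \subset D -> coordinates G -> coordinates (f @* G).
Proof.
move=> injf sGD c; have GD := subsetP sGD.
apply: (@Coordinates _ _ (fun y => code c (invm injf y))).
- move=> _ _ /morphimP[u Du Gu ->] /morphimP[v Dv Gv ->].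
  by rewrite -morphM // !invmE ?groupM // codeM.
- move=> _ _ /morphimP[u Du Gu ->] /morphimP[v Dv Gv ->]; rewrite !invmE //.
  by move/code_inj->.
- by move=> _ /morphimP[u Du Gu ->]; rewrite invmE //; apply: code_sl3.
move=> m /(code_surj c)[u Gu <-]; exists (f u); last by rewrite invmE ?GD.
by rewrite mem_morphim ?GD.
Qed.

Lemma coordinates_SL : coordinates (SL 3 F3).
Proof.
have inE3 (u : {'GL_3[F3]}) : (u \in SL 3 F3) = (code_mx (GLval u) \in sl3).
  by rewrite inE mem_sl3 -(can_eq FofK) -det_mx_of code_mxK.
apply: (@Coordinates _ _ (fun u : {'GL_3[F3]} => code_mx (GLval u))).
- by move=> u v _ _; apply: (can_inj mx_ofK); rewrite mx_ofM !code_mxK GL_MxE.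
- by move=> u v _ _ /(can_inj code_mxK) E; apply: val_inj.
- by move=> u; rewrite inE3.
move=> m m3; have um: mx_of m \in unitmx.
  by rewrite unitmxE det_mx_of; move: m3; rewrite mem_sl3 => /eqP->; rewrite GRing.unitr1.
pose u : {'GL_3[F3]} := Sub (mx_of m) um.
have Eu: code_mx (GLval u) = m by rewrite -[RHS]mx_ofK; congr code_mx; apply: SubK.
by exists u; rewrite ?inE3 Eu.
Qed.

Lemma coordinates_PSL : coordinates (PSL 3 F3).
Proof.
pose Z := 'Z(SL 3 F3); have nZ: SL 3 F3 \subset 'N(Z) by rewrite normal_norm ?center_normal.
apply: (@coordinates_morphim _ _ _ _ (coset_morphism Z)) nZ coordinates_SL.
rewrite ker_coset; apply/trivgP; exact: center_trivial coordinates_SL.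
Qed.

Unset Implicit Arguments.

Theorem theorem3p6 (x : coset_of 'Z(SL 3 'F_3))
    (Gx : x \in PSL 3 'F_3) (x_neq1 : x != 1) :
  let G := PSL 3 'F_3 in
  (#[x] \in [:: 2; 3; 4; 6; 8; 13])
  /\ (#|AGL 2 'F_3| = 432 /\ #|C13_C3| = 39)
  /\ (forall M : {group coset_of 'Z(SL 3 'F_3)}, maximal M G ->
        [\/ M \isog AGL 2 'F_3, M \isog C13_C3 | M \isog [set: 'S_4]])
  /\ Sol G x = \bigcup_(M in maximals_at G x) M
  /\ (#[x] = 2 ->
        [/\ hfs G x = (10, 0, 18)%N, #|Sol G x| = 2832 & #|'N_G(<[x]>)| = 48])
  /\ (#[x] = 3 ->
        [/\ #|'N_G(<[x]>)| \in [:: 18; 108],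
            #|'N_G(<[x]>)| = 18 -> hfs G x = (2, 6, 3)%N /\ #|Sol G x| = 1026
          & #|'N_G(<[x]>)| = 108 -> hfs G x = (8, 0, 0)%N /\ #|Sol G x| = 2376])
  /\ (#[x] = 4 ->
        [/\ hfs G x = (2, 0, 2)%N, #|Sol G x| = 848 & #|'N_G(<[x]>)| = 16])
  /\ (#[x] = 6 ->
        [/\ hfs G x = (4, 0, 0)%N, #|Sol G x| = 1368 & #|'N_G(<[x]>)| = 12])
  /\ (#[x] = 8 ->
        [/\ hfs G x = (2, 0, 0)%N, #|Sol G x| = 816 & #|'N_G(<[x]>)| = 16])
  /\ (#[x] = 13 ->
        [/\ hfs G x = (0, 1, 0)%N, #|Sol G x| = 39 & #|'N_G(<[x]>)| = 39]).
Proof.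
move=> G; have c : coordinates G := coordinates_PSL.
have [i lti [ox hx sx nx]] := element_values c Gx x_neq1.
split; first by rewrite ox; clear -lti; do 7!case: i lti => [|i] lti //.
split; first by rewrite card_AGL2 card_C13_C3.
split; first exact: maximal_isog.
split; first exact: Sol_maximals.
rewrite ox hx sx nx; clear -lti.
by do 7!case: i lti => [|i] lti //.
Qed.
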